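(* Let $0<\alpha<1$ and $a,b,c\in\mathbb{R}$. The equation $D^{\alpha}x(t)+c\,D^{2\alpha}x(t)=a\,x(t)+b\,x(t-\tau)$ is unstable for all $\tau\ge 0$ if any one of the following conditions holds: (i) $c>0$, $b<0$ and $\frac{-a}{b}>1$; (ii) $c>0$, $b>0$ and $\frac{-a}{b}<1$; (iii) $c<0$, $b<0$ and $\frac{-a}{b}<1$; (iv) $c<0$, $b<0$ and $-b<a<\frac{-1}{4c}$.
   Context: $D^{\mu}$ denotes the Caputo fractional derivative (base point $0$) in $t$: for $m\in\mathbb{N}$ and $m-1<\mu<m$, $D^{\mu}f(t)=\frac{1}{\Gamma(m-\mu)}\int_0^t (t-s)^{m-\mu-1}f^{(m)}(s)\,ds$, and $D^{m}f=f^{(m)}$. The equation is considered for $t>0$ with delay $\tau\ge 0$ and a prescribed history on $[-\tau,0]$ (together with a prescribed value $x'(0)$ when $1<2\alpha<2$). The characteristic equation is $\lambda^{\alpha}+c\lambda^{2\alpha}=a+b\,e^{-\lambda\tau}$ (principal branch of powers). For a given $\tau\ge 0$ the equation is called stable if all its solutions are bounded as $t\to\infty$, and unstable if it is not stable. The paper uses as its criterion that the existence of a positive real root $\lambda>0$ of the characteristic equation is sufficient for instability. *)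

(* Defs.v *)
From HB Require Import structures.
From mathcomp Require Import all_boot all_order all_algebra.
From mathcomp Require Import all_classical all_reals all_analysis.

Set Implicit Arguments.
Unset Strict Implicit.
Unset Printing Implicit Defensive.

Import Order.TTheory GRing.Theory Num.Theory.
Import numFieldNormedType.Exports.

Local Open Scope classical_set_scope.
Local Open Scope ring_scope.

Definition Gamma (R : realType) (z : R) : R :=
  \int[@lebesgue_measure R]_(t in `]0, +oo[) (t `^ (z - 1) * expR (- t)).

(* The m with m - 1 < mu <= m, for mu > 0. *)
Definition caputo_order (R : realType) (mu : R) : nat := `|Num.ceil mu|%N.

Definition caputo_integrand (R : realType) (mu : R) (f : R -> R) (t s : R) : R :=
  let m := caputo_order mu in
  (t - s) `^ (m%:R - mu - 1) * derive1n m f s.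

(* Caputo derivative with base point 0. *)
Definition caputo (R : realType) (mu : R) (f : R -> R) (t : R) : R :=
  let m := caputo_order mu in
  if mu == m%:R then derive1n m f t
  else (Gamma (m%:R - mu))^-1 *
       \int[@lebesgue_measure R]_(s in `]0, t[) caputo_integrand mu f t s.

(* [caputo] is total, since [derive1n] and the integral take default values; this
   says that the expressions defining it are meaningful for all t > 0. *)
Definition caputo_exists (R : realType) (mu : R) (f : R -> R) : Prop :=
  let m := caputo_order mu in
  (forall (k : nat) (t : R), (k < m)%N -> 0 < t -> derivable (derive1n k f) t 1) /\
  (mu != m%:R -> forall t : R, 0 < t ->
     (@lebesgue_measure R).-integrable `]0, t[
       (fun s => (caputo_integrand mu f t s)%:E)).

(* x solves D^alpha x(t) + c D^(2 alpha) x(t) = a x(t) + b x(t - tau), t > 0,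
   with history phi on [-tau, 0] and, if 1 < 2 alpha, with x'(0) = v. The
   values of x and phi outside [-tau, +oo[ and [-tau, 0] play no role, nor does
   v if 2 alpha <= 1. Continuity of x makes phi continuous on [-tau, 0] and
   attaches x to its initial value x(0) = phi(0). *)
Record is_solution (R : realType) (alpha a b c tau : R)
    (phi : R -> R) (v : R) (x : R -> R) : Prop := IsSolution {
  solution_history : forall t : R, - tau <= t <= 0 -> x t = phi t ;
  solution_continuous : {within `[- tau, +oo[, continuous x} ;
  solution_velocity : 1 < 2 * alpha ->
    h^-1 * (x h - x 0) @[h --> 0^'+] --> v ;
  solution_caputo1 : caputo_exists alpha x ;
  solution_caputo2 : caputo_exists (2 * alpha) x ;
  solution_equation : forall t : R, 0 < t ->
    caputo alpha x t + c * caputo (2 * alpha) x t = a * x t + b * x (t - tau) }.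

Definition stable (R : realType) (alpha a b c tau : R) : Prop :=
  forall (phi : R -> R) (v : R) (x : R -> R),
    is_solution alpha a b c tau phi v x -> bounded_near x (pinfty_nbhs R).

Definition unstable (R : realType) (alpha a b c tau : R) : Prop :=
  ~ stable alpha a b c tau.

(* Main.v *)
From HB Require Import structures.
Require Import Defs.
From mathcomp Require Import all_boot all_order all_algebra.
From mathcomp Require Import all_classical all_reals all_analysis.
From mathcomp Require Import measurable_realfun.
From mathcomp Require Import ring lra.

Set Implicit Arguments.
Unset Strict Implicit.
Unset Printing Implicit Defensive.

Import Order.TTheory GRing.Theory Num.Theory.
Import numFieldNormedType.Exports.

Local Open Scope classical_set_scope.
Local Open Scope ring_scope.

(** If every solution x were bounded, its Laplace transform would converge at a
positive characteristic root l, where the transformed equation reads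
0 = (transform of the data). So it is enough to construct one solution, with
the regularity that Caputo's definition requires, whose data do not vanish at l.

Write gk b for the kernel t^(b-1) / Gamma(b) of the Riemann-Liouville integral
J_b, so that gk b * gk c = gk (b + c). We look for x = q + J_2 r with r continuous
and q explicit; since D^mu (J_2 r) = J_(2-mu) r, the equation for x reduces to
r = F - J_al r / c + a J_2al r / c + b (J_2al r)(. - tau) / c with F explicit. The
right-hand side is a contraction in r for the weight exp(- M t), M large.

- If tau > 0 the history is free: q(t) = g(t + tau), with g a B-spline supported
  in [0, tau], vanishes for t > 0 and contributes b g(t) as a forcing term. The
  transform of g is a nonzero multiple of (1 - exp(- l tau / 3))^3.
- If tau = 0, q is a partial sum 1 + \sum_n e_n t^((n+2) al) / Gamma((n+2) al + 1)
  of the generalized power series solution, long enough for F to be continuous;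
  the transform of F at l is (a + b) l^(1 - 2 al) / c.

The root l comes from the intermediate value theorem between 0 and a point L at
which L^al + c L^(2 al) dominates a + b E, with the sign of a + b, for all E in
[0, 1]. *)

(** * Affine substitutions in Lebesgue integrals over the line *)

Section affine_substitution.
Context {R : realType}.
Local Notation mu := (@lebesgue_measure R).
Implicit Types (f : R -> \bar R) (a c t : R).
Local Open Scope ereal_scope.

Lemma measurable_addr a :
  measurable_fun setT ((fun x => x + a)%R : measurableTypeR R -> measurableTypeR R).
Proof. by apply: continuous_measurable_fun => x; apply: cvgD => //; exact: cvg_cst. Qed.

Lemma measurable_mull c :
  measurable_fun setT ((fun x => c * x)%R : measurableTypeR R -> measurableTypeR R).
Proof. by apply: continuous_measurable_fun => x; apply: cvgM => //; exact: cvg_cst. Qed.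

Lemma measurable_subl t :
  measurable_fun setT ((fun x => t - x)%R : measurableTypeR R -> measurableTypeR R).
Proof.
by apply: continuous_measurable_fun => x; apply: cvgB => //; exact: cvg_cst.
Qed.

Lemma preimage_addr_itv a (x y : R) :
  (fun z : R => z + a)%R @^-1` `]x, y]%classic = `](x - a)%R, (y - a)%R]%classic.
Proof.
by apply/seteqP; split => z /=; rewrite !in_itv/= ltrBlDr lerBrDr.
Qed.

Lemma preimage_mull_itv c (x y : R) : (0 < c)%R ->
  (fun z : R => c * z)%R @^-1` `]x, y]%classic = `](x / c)%R, (y / c)%R]%classic.
Proof.
move=> c0; apply/seteqP; split => z /=;
  by rewrite !in_itv/= ltr_pdivrMr// ler_pdivlMr// ![(z * c)%R]mulrC.
Qed.

(** Lebesgue measure and its pushforward under a translation agree on half-open intervals, hence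
    everywhere by uniqueness; [ge0_integral_mull] argues alike with a rescaled pushforward. *)
Lemma ge0_integral_addr f a : measurable_fun setT f -> (forall x, 0 <= f x) ->
  \int[mu]_x f (x + a)%R = \int[mu]_x f x.
Proof.
move=> mf f0.
pose m := isMeasurableFun.Build _ _ _ _ _ (measurable_addr a).
pose phi : {mfun measurableTypeR R >-> measurableTypeR R} :=
  HB.pack ((fun x => x + a)%R : measurableTypeR R -> measurableTypeR R) m.
have H A : measurable A -> mu A = pushforward mu phi A.
  apply: (@lebesgue_measure_unique _ (pushforward mu phi)) => //.
  move=> _ [[x y]] _ <-.
  suff : mu `]x, y]%classic = mu `](x - a)%R, (y - a)%R]%classic.
    by rewrite -preimage_addr_itv.
  rewrite !lebesgue_measure_itv/= !lte_fin ltrD2r.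
  by case: ifPn => // _; rewrite -!EFinB; congr EFin; lra.
rewrite -[LHS](@ge0_integral_pushforward _ _ _ _ _ _ (measurable_addr a) mu setT)//.
apply: eq_measure_integral => [|? A mA _]; [exact: measurable_addr|exact/esym/H].
Qed.

Lemma ge0_integral_oppr f : measurable_fun setT f -> (forall x, 0 <= f x) ->
  \int[mu]_x f (- x)%R = \int[mu]_x f x.
Proof.
move=> mf f0.
have mN : measurable_fun setT (-%R : measurableTypeR R -> measurableTypeR R).
  by apply: continuous_measurable_fun; exact: opp_continuous.
rewrite -[LHS](@ge0_integral_pushforward _ _ _ _ _ _ mN mu setT)//.
by apply: eq_measure_integral => A mA _; exact: lebesgue_measureN.
Qed.

Lemma ge0_integral_mull f c : measurable_fun setT f -> (forall x, 0 <= f x) ->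
  (0 < c)%R -> \int[mu]_x f x = c%:E * \int[mu]_x f (c * x)%R.
Proof.
move=> mf f0 c0.
pose m := isMeasurableFun.Build _ _ _ _ _ (measurable_mull c).
pose phi : {mfun measurableTypeR R >-> measurableTypeR R} :=
  HB.pack ((fun x => c * x)%R : measurableTypeR R -> measurableTypeR R) m.
pose k : {nonneg R} := NngNum (ltW c0).
have H A : measurable A -> mu A = mscale k (pushforward mu phi) A.
  apply: (@lebesgue_measure_unique _ (mscale k (pushforward mu phi))) => //.
  move=> _ [[x y]] _ <-.
  suff : mu `]x, y]%classic = c%:E * mu `](x / c)%R, (y / c)%R]%classic.
    by rewrite -preimage_mull_itv.
  rewrite !lebesgue_measure_itv/= !lte_fin.
  rewrite ltr_pM2r ?invr_gt0//.
  case: ifPn => _; rewrite ?mule0// -!EFinB -EFinM; congr EFin.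
  by field; rewrite gt_eqF.
rewrite -[X in _ = _ * X](@ge0_integral_pushforward _ _ _ _ _ _ (measurable_mull c) mu setT)//.
rewrite -(@ge0_integral_mscale _ _ _ _ setT measurableT k)//.
  exact: measurable_mull.
by move=> ?; apply: eq_measure_integral => A mA _; exact: H.
Qed.

Lemma ge0_integral_subl f t : measurable_fun setT f -> (forall x, 0 <= f x) ->
  \int[mu]_x f (t - x)%R = \int[mu]_x f x.
Proof.
move=> mf f0.
transitivity (\int[mu]_x f (t + x)%R).
  rewrite -(@ge0_integral_oppr (fun x => f (t + x)%R))//.
  by under [X in measurable_fun _ X]eq_fun do rewrite addrC;
    apply: measurableT_comp => //; exact: measurable_addr.
by under eq_integral do rewrite addrC; rewrite ge0_integral_addr.
Qed.

Lemma integral_subl f t : measurable_fun setT f ->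
  \int[mu]_x f (t - x)%R = \int[mu]_x f x.
Proof.
move=> mf; rewrite integralE [RHS]integralE; congr (_ - _).
- under eq_integral do rewrite -/((f \o (fun x => t - x)%R) _) funepos_comp/=.
  by rewrite (@ge0_integral_subl f^\+)//; exact: measurable_funepos.
- under eq_integral do rewrite -/((f \o (fun x => t - x)%R) _) funeneg_comp/=.
  by rewrite (@ge0_integral_subl f^\-)//; exact: measurable_funeneg.
Qed.

Lemma integral_addr f a : measurable_fun setT f ->
  \int[mu]_x f (x + a)%R = \int[mu]_x f x.
Proof.
move=> mf; rewrite integralE [RHS]integralE; congr (_ - _).
- under eq_integral do rewrite -/((f \o (fun x => x + a)%R) _) funepos_comp/=.
  by rewrite (@ge0_integral_addr f^\+)//; exact: measurable_funepos.
- under eq_integral do rewrite -/((f \o (fun x => x + a)%R) _) funeneg_comp/=.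
  by rewrite (@ge0_integral_addr f^\-)//; exact: measurable_funeneg.
Qed.

End affine_substitution.

(** * The Gamma function *)

Section Gamma_function.
Context {R : realType}.
Local Notation mu := (@lebesgue_measure R).
Implicit Types (z t l : R).

Lemma continuous_powR_gt0 z t : 0 < t -> {for t, continuous (@powR R ^~ z)}.
Proof.
by move=> t0; apply/differentiable_continuous/derivable1_diffP/derivable_powR;
  rewrite in_itv/= andbT.
Qed.

(** Fundamental theorem for the antiderivative t^z / z. The bound does not depend on [a], which lets
    [a] tend to 0 even when z < 1 and the integrand is singular there. *)
Lemma integral_powR_seg z (a : R) : 0 < z -> 0 < a < 1 ->
  (\int[mu]_(t in `[a, 1%R]) (t `^ (z - 1))%:E <= (z^-1)%:E)%E.
Proof.
move=> z0 /andP[a0 a1].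
rewrite (@continuous_FTC2 _ _ (fun t => z^-1 * t `^ z))//.
- rewrite -EFinB lee_fin powR1/= mulr1 lerBlDr lerDl.
  by rewrite mulr_ge0 ?powR_ge0// invr_ge0 ltW.
- apply: continuous_in_subspaceT => x /set_mem/=; rewrite in_itv/= => /andP[ax _].
  exact/continuous_powR_gt0/(lt_le_trans a0).
- have cf x : 0 < x -> {for x, continuous (fun t : R => z^-1 * t `^ z)}.
    by move=> x0; apply: cvgM; [exact: cvg_cst|exact: continuous_powR_gt0].
  split.
  + move=> x; rewrite in_itv/= => /andP[ax _].
    apply: derivableM; first exact: derivable_cst.
    by apply: derivable_powR; rewrite in_itv/= andbT (lt_trans a0).
  + by apply: cvg_at_right_filter; exact: cf.
  + by apply: cvg_at_left_filter; exact: cf.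
- move=> x; rewrite in_itv/= => /andP[ax _].
  have x0 : 0 < x by exact: lt_trans ax.
  rewrite derive1Ml; last by apply: derivable_powR; rewrite in_itv/= andbT.
  by rewrite powR_derive1 ?in_itv/= ?andbT// mulrA mulVf ?mul1r// gt_eqF.
Qed.

Lemma integral_powR_unit z : 0 < z ->
  (\int[mu]_(t in `]0%R, 1%R]) (t `^ (z - 1))%:E <= (z^-1)%:E)%E.
Proof.
(* The index [n.+2] keeps the left end point strictly below 1, as [integral_powR_seg] requires;
   monotone convergence then reaches 0. *)
move=> z0; pose F n : set R := `[n.+2%:R^-1, 1]%classic.
have -> : `]0%R, 1%R]%classic = \bigcup_n F n :> set R.
  apply/seteqP; split => x /=.
    rewrite in_itv/= => /andP[x0 x1].
    exists (Num.truncn x^-1) => //=; rewrite /F/= in_itv/= x1 andbT.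
    rewrite invf_ple ?posrE// ltW// (lt_le_trans (truncnS_gt _))//.
    by rewrite ler_nat.
  by move=> [n _] /=; rewrite /F/= !in_itv/= => /andP[nx ->]; rewrite andbT (lt_le_trans _ nx).
have mf : measurable_fun setT (fun t : R => (t `^ (z - 1))%:E).
  by apply/measurable_EFinP; exact: measurable_powR.
have : ((\int[mu]_(t in F i) (t `^ (z - 1))%:E) @[i --> \oo] -->
    \int[mu]_(t in \bigcup_n F n) (t `^ (z - 1))%:E)%E.
  apply: ge0_nondecreasing_set_cvg_integral => //.
  - apply/nondecreasing_seqP => n; rewrite subsetEset; apply: subset_itvr.
    by rewrite bnd_simp lef_pV2 ?posrE// ler_nat.
  - by move=> i; exact: measurable_itv.
  - by move=> i; exact: measurable_funTS.
  - by move=> i x _; rewrite lee_fin powR_ge0.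
move=> /cvg_lim <- //; apply: lime_le; last first.
  apply: nearW => n; apply: integral_powR_seg => //.
  by rewrite invr_gt0// ltr0n/= invf_lt1// ltr1n.
apply: ereal_nondecreasing_is_cvgn.
apply: ge0_nondecreasing_set_nondecreasing_integral => //.
- apply/nondecreasing_seqP => n; rewrite subsetEset; apply: subset_itvr.
  by rewrite bnd_simp lef_pV2 ?posrE// ler_nat.
- by move=> i; exact: measurable_itv.
- by move=> i; exact: measurable_funTS.
- by move=> i x _; rewrite lee_fin powR_ge0.
Qed.

(** The inequality ln y < y at y = t / (2 z) trades the power for half of the exponential decay.
    With 1 <= t the exponent z - 1 may be raised to z. *)
Lemma powR_expR_bound z t : 0 < z -> 1 <= t ->
  t `^ (z - 1) * expR (- t) <= expR (z * ln (2 * z)) * expR (- (t / 2)).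
Proof.
move=> z0 t1; have t0 : 0 < t by exact: lt_le_trans t1.
rewrite /powR gt_eqF// -!expRD ler_expR.
have z20 : 0 < 2 * z by rewrite mulr_gt0.
have := @ln_sublinear _ (t / (2 * z)).
rewrite divr_gt0// ln_div ?posrE// => /(_ isT) h.
have l0 : 0 <= ln t by exact: ln_ge0.
have : z * (ln t - ln (2 * z)) <= z * (t / (2 * z)) by rewrite ler_pM2l// ltW.
have -> : z * (t / (2 * z)) = t / 2 by field; rewrite gt_eqF.
lra.
Qed.

Lemma integral_expR_half : (\int[mu]_(t in `[0%R, +oo[) (expR (- (t / 2)))%:E = 2%:E)%E.
Proof.
have := @integral_exponential_pdf R 2^-1 _ => /(_ ltac:(by rewrite invr_gt0)) h.
rewrite integral_mkcond.
have : (2%:E * \int[mu]_x (exponential_pdf 2^-1 x)%:E = 2%:E * 1)%E by rewrite h.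
rewrite mule1 => <-; rewrite -ge0_integralZl//.
- apply: eq_integral => x _; rewrite -EFinM /exponential_pdf !patchE; case: ifP => _.
    by rewrite mulrA mulfV// mul1r mulNr [2^-1 * _]mulrC.
  by rewrite mulr0.
- apply/measurable_EFinP; exact: measurable_exponential_pdf.
- by move=> x _; rewrite lee_fin exponential_pdf_ge0.
Qed.

Lemma measurable_Gamma_integrand z (D : set R) :
  measurable_fun D (fun t : R => t `^ (z - 1) * expR (- t)).
Proof.
apply: measurable_funTS; apply: measurable_funM; first exact: measurable_powR.
by apply: measurableT_comp => //; exact: measurableT_comp.
Qed.

Lemma Gamma_integrand_ge0 z t : 0 <= t `^ (z - 1) * expR (- t).
Proof. by rewrite mulr_ge0 ?powR_ge0 ?expR_ge0. Qed.

(** Split at 1: on the left the power dominates the integrand, on the right a multiple of exp(- t /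
    2) does, by [powR_expR_bound]. *)
Lemma Gamma_integral_lty z : 0 < z ->
  (\int[mu]_(t in `]0%R, +oo[) (t `^ (z - 1) * expR (- t))%:E < +oo)%E.
Proof.
move=> z0.
have -> : `]0%R, +oo[%classic = `]0, 1]%classic `|` `]1, +oo[%classic :> set R.
  by apply/seteqP; split => x /=; rewrite !in_itv/= ?andbT; [case: (leP x 1) => h;
   [rewrite andbT; left|right]|move=> [/andP[]//|]; apply: lt_trans].
rewrite ge0_integral_setU//=; last 3 first.
- by apply/measurable_EFinP; exact: measurable_Gamma_integrand.
- by move=> x _; rewrite lee_fin Gamma_integrand_ge0.
- apply/disj_setPS => x /= []; rewrite !in_itv/= andbT => /andP[_ x1].
  by rewrite ltNge x1.
apply: lte_add_pinfty.
- apply: (@le_lt_trans _ _ (\int[mu]_(t in `]0%R, 1%R]) (t `^ (z - 1))%:E)%E).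
    apply: ge0_le_integral => //.
    + by move=> x _; rewrite lee_fin Gamma_integrand_ge0.
    + by apply/measurable_EFinP; exact: measurable_Gamma_integrand.
    + by apply/measurable_EFinP; apply: measurable_funTS; exact: measurable_powR.
    + move=> x /=; rewrite in_itv/= => /andP[x0 _].
      rewrite lee_fin ler_piMr ?powR_ge0// -expR0 ler_expR oppr_le0; exact: ltW.
  exact: (le_lt_trans (integral_powR_unit z0) (ltry _)).
- have mh : measurable_fun setT (fun x : R => expR (- (x / 2))).
    by apply: measurableT_comp => //; apply: measurableT_comp => //; exact: measurable_funM.
  pose h (t : R) := expR (z * ln (2 * z)) * expR (- (t / 2)).
  have mK (D : set R) : measurable_fun D (EFin \o h).
    by apply/measurable_EFinP; apply: measurable_funTS; exact: measurable_funM.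
  apply: (@le_lt_trans _ _ (\int[mu]_(t in `[0%R, +oo[) (h t)%:E)%E).
    apply: (@le_trans _ _ (\int[mu]_(t in `]1%R, +oo[) (h t)%:E)%E); last first.
      apply: ge0_subset_integral => //.
      + exact: mK.
      + by move=> x _; rewrite lee_fin mulr_ge0 ?expR_ge0.
      + by move=> x /=; rewrite !in_itv/= !andbT => /ltW; apply: le_trans.
    apply: ge0_le_integral => //.
    + by move=> x _; rewrite lee_fin Gamma_integrand_ge0.
    + by apply/measurable_EFinP; exact: measurable_Gamma_integrand.
    + exact: mK.
    + move=> x /=; rewrite in_itv/= andbT => x1.
      by rewrite lee_fin powR_expR_bound// ltW.
  under eq_integral do rewrite EFinM.
  rewrite ge0_integralZl//.
  + by rewrite integral_expR_half -EFinM ltry.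
  + by apply/measurable_EFinP; exact: measurable_funTS.
Qed.

Lemma GammaE z : 0 < z -> ((Gamma z)%:E =
  \int[mu]_(t in `]0%R, +oo[) (t `^ (z - 1) * expR (- t))%:E)%E.
Proof.
move=> z0; rewrite /Gamma /Rintegral fineK// ge0_fin_numE ?Gamma_integral_lty//.
by apply: integral_ge0 => x _; rewrite lee_fin Gamma_integrand_ge0.
Qed.

(** A vanishing integral would make the integrand zero almost everywhere, but it is positive on a
    set of infinite measure. *)
Lemma Gamma_gt0 z : 0 < z -> 0 < Gamma z.
Proof.
move=> z0; rewrite -lte_fin GammaE// lt0e integral_ge0 ?andbT; last first.
  by move=> x _; rewrite lee_fin Gamma_integrand_ge0.
apply/eqP => h.
have : (\int[mu]_(t in `]0%R, +oo[) `|(t `^ (z - 1) * expR (- t))%:E| = 0)%E.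
  rewrite -[RHS]h; apply: eq_integral => x _.
  by rewrite gee0_abs// lee_fin Gamma_integrand_ge0.
move=> /ae_eq_integral_abs -/(_ _ _)[]//.
  by apply/measurable_EFinP; exact: measurable_Gamma_integrand.
move=> N [mN N0 hN].
have : (mu `]0%R, +oo[ <= mu N)%E.
  apply: le_measure; rewrite ?inE// => x xi.
  apply: hN => /= /(_ xi) [] /eqP; apply/negP; rewrite gt_eqF// mulr_gt0 ?expR_gt0//.
  by apply: powR_gt0; move: xi; rewrite /= in_itv/= andbT.
by rewrite N0 lebesgue_measure_itv/= ltry addye.
Qed.

End Gamma_function.

(** * Fractional integrals *)

(* The density of the Riemann-Liouville integral of order b. *)
HB.lock Definition gk (R : realType) (b t : R) : R :=
  if 0 < t then t `^ (b - 1) / Gamma b else 0.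

Section fractional_kernel.
Context {R : realType}.
Local Notation mu := (@lebesgue_measure R).
Implicit Types (b c t l s : R).

Lemma gk_gt0E b t : 0 < t -> gk b t = t `^ (b - 1) / Gamma b.
Proof. by rewrite gk.unlock => ->. Qed.

Lemma gk_le0E b t : t <= 0 -> gk b t = 0.
Proof. by rewrite gk.unlock ltNge => ->. Qed.

Lemma gk_ge0 b t : 0 < b -> 0 <= gk b t.
Proof.
by move=> b0; rewrite gk.unlock; case: ifP => // _; rewrite divr_ge0 ?powR_ge0// ltW// Gamma_gt0.
Qed.

Lemma gkM b t s : 0 < t -> gk b (t * s) = t `^ (b - 1) * gk b s.
Proof.
move=> t0; rewrite gk.unlock pmulr_rgt0//; case: ifPn => s0; last by rewrite mulr0.
by rewrite powRM ?ltW// mulrA.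
Qed.

Lemma measurable_gk b : measurable_fun setT (gk b : R -> R).
Proof.
rewrite gk.unlock.
apply: measurable_fun_ifT => //.
- exact: measurable_fun_ltr.
- by apply: measurable_funM => //; exact: measurable_powR.
Qed.

Lemma measurable_expRM l : measurable_fun setT (fun s : R => expR (- (l * s))).
Proof.
by apply: measurableT_comp => //; apply: measurableT_comp => //; exact: measurable_funM.
Qed.

Lemma laplace_gk1 b : 0 < b -> (\int[mu]_s (gk b s * expR (- s))%:E = 1)%E.
Proof.
move=> b0.
transitivity (\int[mu]_(s in `]0%R, +oo[) (((Gamma b)^-1)%:E * (s `^ (b - 1) * expR (- s))%:E))%E.
  rewrite [RHS]integral_mkcond; apply: eq_integral => s _.
  rewrite patchE mem_setE in_itv/= andbT gk.unlock; case: ifP => _; last by rewrite mul0r.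
  by rewrite -EFinM; congr EFin; ring.
rewrite ge0_integralZl//.
- by rewrite -GammaE// -EFinM mulVf// gt_eqF// Gamma_gt0.
- by apply/measurable_EFinP; exact: measurable_Gamma_integrand.
- by move=> s _; rewrite lee_fin Gamma_integrand_ge0.
- by rewrite lee_fin invr_ge0 ltW// Gamma_gt0.
Qed.

(** The substitution s -> l s and the homogeneity [gkM] reduce this to the case l = 1, which is the
    definition of [Gamma]. *)
Lemma laplace_gk b l : 0 < b -> 0 < l ->
  (\int[mu]_s (gk b s * expR (- (l * s)))%:E = (l `^ (- b))%:E)%E.
Proof.
move=> b0 l0.
have mk : measurable_fun setT (fun s => gk b s * expR (- s)).
  apply: measurable_funM; first exact: measurable_gk.
  by apply: measurableT_comp => //; exact: measurableT_comp.
have k0 s : 0 <= gk b s * expR (- s) by rewrite mulr_ge0 ?gk_ge0 ?expR_ge0.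
have := laplace_gk1 b0; rewrite (ge0_integral_mull (c := l))//; last first.
  by apply/measurable_EFinP.
under eq_integral do rewrite gkM// -mulrA EFinM.
rewrite ge0_integralZl//; last 3 first.
- apply/measurable_EFinP; apply: measurable_funM; first exact: measurable_gk.
  exact: measurable_expRM.
- by move=> s _; rewrite lee_fin mulr_ge0 ?gk_ge0 ?expR_ge0.
- by rewrite lee_fin powR_ge0.
rewrite muleA -EFinM mulr_powRB1 ?ltW// => h.
have lb0 : 0 < l `^ b by exact: powR_gt0.
have : ((l `^ b)^-1%:E * ((l `^ b)%:E * \int[mu]_s (gk b s * expR (- (l * s)))%:E) = (l `^ b)^-1%:E * 1)%E.
  by rewrite h.
by rewrite muleA -EFinM mulVf ?gt_eqF// mul1e mule1 powRN.
Qed.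

Lemma powR_mul3 b c t : 0 < t -> t * (t `^ (b - 1) * t `^ (c - 1)) = t `^ (b + c - 1).
Proof.
move=> t0; have tn s : (s == 0) ==> (t != 0) by rewrite (gt_eqF t0) implybT.
by rewrite -{1}[t]powRr1 ?ltW// -!powRD//; congr (_ `^ _); lra.
Qed.

(** Convolution of two kernels, in the extended reals because its finiteness is only known once
    [ge0_gk_semigroup] has identified it. *)
Let ek b c t : \bar R := (\int[mu]_s (gk b s * gk c (t - s))%:E)%E.

Lemma measurable_gk_subr c t : measurable_fun setT (fun s => gk c (t - s)).
Proof.
by apply: measurableT_comp; [exact: measurable_gk|exact: measurable_funB].
Qed.

Let ek_scale b c t : 0 < b -> 0 < c -> 0 < t ->
  ek b c t = ((t `^ (b + c - 1))%:E * ek b c 1)%E.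
Proof.
move=> b0 c0 t0; rewrite [LHS](@ge0_integral_mull _ (fun s => (gk b s * gk c (t - s))%:E) t)//; last 2 first.
- by apply/measurable_EFinP/measurable_funM; [exact: measurable_gk|exact: measurable_gk_subr].
- by move=> s; rewrite lee_fin mulr_ge0 ?gk_ge0.
have E s : gk b (t * s) * gk c (t - t * s) =
    (t `^ (b - 1) * t `^ (c - 1)) * (gk b s * gk c (1 - s)).
  by rewrite -[X in X - _]mulr1 -mulrBr !gkM//; ring.
under eq_integral do rewrite E EFinM.
rewrite ge0_integralZl//; last 3 first.
- apply/measurable_EFinP; apply: measurable_funM; [exact: measurable_gk|exact: measurable_gk_subr].
- by move=> s _; rewrite lee_fin mulr_ge0 ?gk_ge0.
- by rewrite lee_fin mulr_ge0 ?powR_ge0.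
rewrite muleA -EFinM; congr (_%:E * _)%E.
by rewrite powR_mul3.
Qed.

Let ek_le0 b c t : t <= 0 -> ek b c t = 0%E.
Proof.
move=> t0; apply: integral0_eq => s _; have [s0|s0] := ltP 0 s.
  by rewrite (@gk_le0E c) ?mulr0// subr_le0 (le_trans t0)// ltW.
by rewrite gk_le0E ?mul0r.
Qed.

Let ekE b c t : 0 < b -> 0 < c ->
  ek b c t = (ek b c 1 * (Gamma (b + c) * gk (b + c) t)%:E)%E.
Proof.
move=> b0 c0; have [t0|t0] := ltP 0 t; last by rewrite ek_le0// gk_le0E// mulr0 mule0.
rewrite ek_scale// muleC; congr (_ * _%:E)%E.
by rewrite gk_gt0E// mulrC divfK// gt_eqF// Gamma_gt0// addr_gt0.
Qed.

Let ek_ge0 b c t : 0 < b -> 0 < c -> (0 <= ek b c t)%E.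
Proof.
by move=> b0 c0; apply: integral_ge0 => s _; rewrite lee_fin mulr_ge0 ?gk_ge0.
Qed.

(** By Tonelli and the splitting exp(- t) = exp(- s) exp(- (t - s)), the transform at 1 of the
    convolution is the product of two transforms equal to 1. *)
Let laplace_ek b c : 0 < b -> 0 < c ->
  (\int[mu]_t (ek b c t * (expR (- t))%:E) = 1)%E.
Proof.
move=> b0 c0.
pose F (p : R * R) := (gk b p.2 * gk c (p.1 - p.2) * expR (- p.1))%:E.
have mF : measurable_fun setT F.
  apply/measurable_EFinP; apply: measurable_funM.
    apply: measurable_funM; first exact: measurableT_comp (measurable_gk b) _.
    by apply: measurableT_comp (measurable_gk c) _; exact: measurable_funB.
  by apply: measurableT_comp => //; exact: measurableT_comp.
have F0 p : (0 <= F p)%E by rewrite lee_fin !mulr_ge0 ?gk_ge0 ?expR_ge0.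
transitivity (\int[mu]_t \int[mu]_s F (t, s))%E.
  apply: eq_integral => t _; rewrite /ek muleC -ge0_integralZl//.
  - by apply: eq_integral => s _; rewrite -EFinM /F/= mulrC.
  - by apply/measurable_EFinP/measurable_funM; [exact: measurable_gk|exact: measurable_gk_subr].
  - by move=> s _; rewrite lee_fin mulr_ge0 ?gk_ge0.
rewrite -[LHS]/(\int[mu]_t fubini_F mu F t)%E fubini_tonelli//.
transitivity (\int[mu]_s (gk b s * expR (- s))%:E)%E; last exact: laplace_gk1.
apply: eq_integral => s _; rewrite /fubini_G.
transitivity (\int[mu]_t ((gk b s * expR (- s))%:E * (gk c (t - s) * expR (- (t - s)))%:E))%E.
  apply: eq_integral => t _; rewrite -EFinM /F/=; congr EFin.
  by rewrite [- (t - s)]opprB expRD [expR (- s)]expRN; field; rewrite gt_eqF// expR_gt0.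
rewrite ge0_integralZl//.
- rewrite (ge0_integral_addr (f := fun t => (gk c t * expR (- t))%:E)).
  + by rewrite laplace_gk1// mule1.
  + apply/measurable_EFinP; apply: measurable_funM; first exact: measurable_gk.
    by apply: measurableT_comp => //; exact: measurableT_comp.
  + by move=> t; rewrite lee_fin mulr_ge0 ?gk_ge0 ?expR_ge0.
- apply/measurable_EFinP; apply: measurable_funM.
    by apply: measurableT_comp (measurable_gk c) _; exact: measurable_funB.
  by apply: measurableT_comp => //; apply: measurableT_comp => //; exact: measurable_funB.
- by move=> t _; rewrite lee_fin mulr_ge0 ?gk_ge0 ?expR_ge0.
- by rewrite lee_fin mulr_ge0 ?gk_ge0 ?expR_ge0.
Qed.

(* Scaling gives gk b * gk c = C gk (b + c); the constant is read off the Laplace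
   transform at 1, so the Beta function never appears. *)
Lemma ge0_gk_semigroup b c t : 0 < b -> 0 < c ->
  (\int[mu]_s (gk b s * gk c (t - s))%:E = (gk (b + c) t)%:E)%E.
Proof.
move=> b0 c0; rewrite -/(ek b c t).
have G0 : 0 < Gamma (b + c) by rewrite Gamma_gt0// addr_gt0.
have bc0 : 0 < b + c by exact: addr_gt0.
transitivity (ek b c 1 * (Gamma (b + c))%:E * (gk (b + c) t)%:E)%E.
  by rewrite ekE// EFinM muleA.
suff -> : (ek b c 1 * (Gamma (b + c))%:E = 1)%E by rewrite mul1e.
rewrite -[RHS](laplace_ek b0 c0).
transitivity (\int[mu]_s ((ek b c 1 * (Gamma (b + c))%:E) * (gk (b + c) s * expR (- s))%:E))%E.
  rewrite ge0_integralZl//.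
  - by rewrite laplace_gk1// mule1.
  - apply/measurable_EFinP; apply: measurable_funM; first exact: measurable_gk.
    by apply: measurableT_comp => //; exact: measurableT_comp.
  - by move=> s _; rewrite lee_fin mulr_ge0 ?gk_ge0 ?expR_ge0.
  - by rewrite mule_ge0 ?ek_ge0// lee_fin ltW.
by apply: eq_integral => s _; rewrite (ekE s)// !EFinM !muleA.
Qed.

End fractional_kernel.

(* The Riemann-Liouville integral of order b with base point 0, for functions
   vanishing on the negative half-line. *)
HB.lock Definition rl_int (R : realType) (b : R) (f : R -> R) (t : R) : R :=
  \int[@lebesgue_measure R]_s (gk b s * f (t - s)).

(** The least such [C] is the supremum norm of [f] with weight exp(- M t). *)
Definition exp_bound (R : realType) (M C : R) (f : R -> R) :=
  forall t, `|f t| <= C * expR (M * t).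

(** The functions among which [r] is sought. Vanishing up to and including 0 makes convolutions over
    the whole line equal to integrals over [0, t], and makes delayed copies tame again. *)
Record tame (R : realType) (M : R) (f : R -> R) : Prop := Tame {
  tame_continuous : continuous f ;
  tame_le0 : forall t, t <= 0 -> f t = 0 ;
  tame_bound : exists C, exp_bound M C f }.

(** * Riemann-Liouville integrals of continuous functions of exponential growth *)

Section rl_integral.
Context {R : realType}.
Local Notation mu := (@lebesgue_measure R).
Implicit Types (b c t l s M C k : R) (f g : R -> R).

Lemma tame_measurable M f : tame M f -> measurable_fun setT f.
Proof. by case=> cf _ _; exact: continuous_measurable_fun. Qed.

Lemma exp_bound_ge0 M C f : exp_bound M C f -> 0 <= C.
Proof.
by move=> /(_ 0) /(le_trans (normr_ge0 _)); rewrite pmulr_lge0// expR_gt0.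
Qed.

Lemma tame0 M : tame M (cst (0 : R)).
Proof.
split=> //; first by move=> ?; exact: cvg_cst.
by exists 0 => t; rewrite normr0 mul0r.
Qed.

Lemma tameD M f g : tame M f -> tame M g -> tame M (fun t => f t + g t).
Proof.
move=> [cf f0 [C fC]] [cg g0 [D gD]]; split.
- by move=> t; apply: cvgD; [exact: cf|exact: cg].
- by move=> t t0; rewrite f0// g0// addr0.
- exists (C + D) => t; rewrite mulrDl (le_trans (ler_normD _ _))//.
  by apply: lerD; [exact: fC|exact: gD].
Qed.

Lemma tameZ M k f : tame M f -> tame M (fun t => k * f t).
Proof.
move=> [cf f0 [C fC]]; split.
- by move=> t; apply: cvgM; [exact: cvg_cst|exact: cf].
- by move=> t t0; rewrite f0// mulr0.
- exists (`|k| * C) => t; rewrite normrM -mulrA ler_wpM2l//; exact: fC.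
Qed.

Lemma tame_shift M f d : 0 <= d -> tame M f -> tame M (fun t => f (t - d)).
Proof.
move=> d0 [cf f0 [C fC]]; split.
- move=> t; apply: continuous_comp; last exact: cf.
  by apply: cvgB => //; exact: cvg_cst.
- by move=> t t0; rewrite f0// subr_le0 (le_trans t0).
- exists (C * expR (- (M * d))) => t.
  rewrite -mulrA -expRD (_ : - (M * d) + M * t = M * (t - d)); last by ring.
  exact: fC.
Qed.

Lemma measurable_subr_comp f t : measurable_fun setT f ->
  measurable_fun setT (fun s => f (t - s)).
Proof.
by move=> mf; apply: measurableT_comp; [exact: mf|exact: measurable_funB].
Qed.

Lemma measurable_rl_integrand b f t : measurable_fun setT f ->
  measurable_fun setT (fun s => gk b s * f (t - s)).
Proof.
by move=> mf; apply: measurable_funM; [exact: measurable_gk|exact: measurable_subr_comp].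
Qed.

Lemma integrable_gk b l : 0 < b -> 0 < l ->
  mu.-integrable setT (fun s => (gk b s * expR (- (l * s)))%:E).
Proof.
move=> b0 l0; apply/integrableP; split.
  by apply/measurable_EFinP/measurable_funM; [exact: measurable_gk|exact: measurable_expRM].
under eq_integral do rewrite gee0_abs ?lee_fin ?mulr_ge0 ?gk_ge0 ?expR_ge0//.
by rewrite laplace_gk// ltry.
Qed.

(** As exp(M (t - s)) splits into exp(M t) and exp(- M s), the integrand is dominated by that of the
    Laplace transform of the kernel at [M]. *)
Lemma rl_integrand_le M C b f t s : 0 < b -> exp_bound M C f ->
  `|gk b s * f (t - s)| <= C * expR (M * t) * (gk b s * expR (- (M * s))).
Proof.
move=> b0 fC; rewrite normrM ger0_norm ?gk_ge0// mulrCA ler_wpM2l ?gk_ge0//.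
by rewrite -mulrA -expRD -mulrBr; exact: fC.
Qed.

Lemma integrable_rl M C b f t : 0 < b -> 0 < M -> measurable_fun setT f ->
  exp_bound M C f ->
  mu.-integrable setT (fun s => (gk b s * f (t - s))%:E).
Proof.
move=> b0 M0 mf fC.
apply: (@le_integrable _ _ _ mu setT measurableT _
  (fun s => ((C * expR (M * t))%:E * (gk b s * expR (- (M * s)))%:E)%E)).
- by apply/measurable_EFinP; exact: measurable_rl_integrand.
- move=> s _; rewrite -EFinM lee_fin [leRHS]ger0_norm.
    exact: rl_integrand_le.
  by rewrite !mulr_ge0 ?expR_ge0 ?gk_ge0 ?(exp_bound_ge0 fC).
- by apply: integrableZl => //; exact: integrable_gk.
Qed.

Lemma tame_integrable M b f t : 0 < b -> 0 < M -> tame M f ->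
  mu.-integrable setT (fun s => (gk b s * f (t - s))%:E).
Proof.
move=> b0 M0 tf; have [C fC] := tame_bound tf.
by apply: integrable_rl M0 _ fC => //; exact: tame_measurable tf.
Qed.

Lemma rl_intE M b f t : 0 < b -> 0 < M -> tame M f ->
  ((rl_int b f t)%:E = \int[mu]_s (gk b s * f (t - s))%:E)%E.
Proof.
move=> b0 M0 tf; rewrite rl_int.unlock /Rintegral fineK//.
exact: integrable_fin_num (tame_integrable _ b0 M0 tf).
Qed.

(** In the weighted norm the operator norm is at most M^(- b), the transform of the kernel at [M].
    It tends to 0 as [M] grows, which is the source of the contraction estimate. *)
Lemma rl_int_bound M C b f : 0 < b -> 0 < M -> tame M f -> exp_bound M C f ->
  exp_bound M (C * M `^ (- b)) (rl_int b f).
Proof.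
move=> b0 M0 tf fC t; rewrite -lee_fin.
rewrite -[leLHS]/(`|(rl_int b f t)%:E|%E) (rl_intE _ _ M0 tf)//.
apply: (le_trans (le_abse_integral _ _ _)) => //.
  exact: measurable_int (tame_integrable _ b0 M0 tf).
apply: (@le_trans _ _ (\int[mu]_s ((C * expR (M * t))%:E * (gk b s * expR (- (M * s)))%:E))%E).
  apply: ge0_le_integral => //.
  - by apply: measurableT_comp => //; exact: measurable_int (tame_integrable _ b0 M0 tf).
  - apply: measurable_funeM; apply: measurable_int (integrable_gk b0 M0).
  - by move=> s _; rewrite -EFinM lee_fin rl_integrand_le.
rewrite ge0_integralZl//.
- by rewrite laplace_gk// -EFinM lee_fin mulrAC.
- exact: measurable_int (integrable_gk b0 M0).
- by move=> s _; rewrite lee_fin mulr_ge0 ?gk_ge0 ?expR_ge0.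
- by rewrite lee_fin mulr_ge0 ?expR_ge0 ?(exp_bound_ge0 fC).
Qed.

Lemma rl_int_le0 b f t : (forall s, s <= 0 -> f s = 0) -> t <= 0 -> rl_int b f t = 0.
Proof.
move=> f0 t0; rewrite rl_int.unlock /Rintegral integral0_eq// => s _.
have [s0|s0] := ltP 0 s; last by rewrite gk_le0E ?mul0r.
by rewrite f0 ?mulr0// subr_le0 (le_trans t0)// ltW.
Qed.

Lemma continuous_rl_int M b f : 0 < b -> 0 < M -> tame M f -> continuous (rl_int b f).
Proof.
move=> b0 M0 tf t; rewrite rl_int.unlock.
have [C fC] := tame_bound tf; have C0 := exp_bound_ge0 fC.
have /= := @continuity_under_integral R _ _ mu (fun t s => gk b s * f (t - s))
  setT measurableT (t - 1) (t + 1) _ _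
  (* One dominating function for all points of the window ]t - 1, t + 1[, from the growth bound at
     its right end. *)
  (fun s => C * expR (M * (t + 1)) * (gk b s * expR (- (M * s)))) _ _.
apply.
- by move=> x _; exact: tame_integrable M0 tf.
- apply: aeW => s _ x _; apply: cvgM; first exact: cvg_cst.
  apply: (@continuous_comp _ _ _ (fun x => x - s) f); last exact: tame_continuous tf _.
  by apply: cvgB => //; exact: cvg_cst.
- exact: (integrableZl measurableT (C * expR (M * (t + 1))) (integrable_gk b0 M0)).
- move=> x; rewrite /= in_itv/= => /andP[_ xt]; apply: aeW => s _.
  apply: (le_trans (rl_integrand_le _ _ b0 fC)).
  rewrite ler_wpM2r ?mulr_ge0 ?gk_ge0 ?expR_ge0// ler_wpM2l// ler_expR.
  by rewrite ler_pM2l// ltW.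
- by rewrite inE/= in_itv/=; apply/andP; split; lra.
Qed.

Lemma tame_rl_int M b f : 0 < b -> 0 < M -> tame M f -> tame M (rl_int b f).
Proof.
move=> b0 M0 tf; split.
- exact: continuous_rl_int M0 tf.
- by move=> t; apply: rl_int_le0; exact: tame_le0 tf.
- have [C fC] := tame_bound tf.
  by exists (C * M `^ (- b)); exact: rl_int_bound.
Qed.

(** Convergence of the integral defining [rl_int], for functions such as [gk c] with c < 1 that are
    singular at 0 and thus not tame. *)
Definition rl_cvg b f := forall t, mu.-integrable setT (fun s => (gk b s * f (t - s))%:E).

Lemma rl_cvg_tame M b f : 0 < b -> 0 < M -> tame M f -> rl_cvg b f.
Proof. by move=> b0 M0 tf t; exact: tame_integrable M0 tf. Qed.

Lemma rl_cvg_intD b f g t : rl_cvg b f -> rl_cvg b g ->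
  rl_int b (fun t => f t + g t) t = rl_int b f t + rl_int b g t.
Proof.
move=> bf bg; rewrite rl_int.unlock -RintegralD//.
- by apply: eq_Rintegral => s _; rewrite mulrDr.
- exact: bf.
- exact: bg.
Qed.

Lemma rl_cvg_intZ b k f t : rl_cvg b f ->
  rl_int b (fun t => k * f t) t = k * rl_int b f t.
Proof.
move=> bf; rewrite rl_int.unlock -RintegralZl//.
- by apply: eq_Rintegral => s _; rewrite mulrCA.
- exact: bf.
Qed.

Lemma rl_intD M b f g t : 0 < b -> 0 < M -> tame M f -> tame M g ->
  rl_int b (fun t => f t + g t) t = rl_int b f t + rl_int b g t.
Proof. by move=> b0 M0 tf tg; apply: rl_cvg_intD; exact: rl_cvg_tame M0 _. Qed.

Lemma rl_intZ M b k f t : 0 < b -> 0 < M -> tame M f ->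
  rl_int b (fun t => k * f t) t = k * rl_int b f t.
Proof. by move=> b0 M0 tf; apply: rl_cvg_intZ; exact: rl_cvg_tame M0 tf. Qed.

Lemma rl_int_shift b f d t : rl_int b (fun t => f (t - d)) t = rl_int b f (t - d).
Proof.
by rewrite rl_int.unlock; apply: eq_Rintegral => s _; rewrite addrAC.
Qed.

Lemma rl_int_gk b c t : 0 < b -> 0 < c -> rl_int b (gk c) t = gk (b + c) t.
Proof. by move=> b0 c0; rewrite rl_int.unlock /Rintegral ge0_gk_semigroup. Qed.

End rl_integral.

(** * Semigroup law and Laplace transform of fractional integrals *)

Section rl_composition.
Context {R : realType}.
Local Notation mu := (@lebesgue_measure R).
Implicit Types (b c t l s v M C k : R) (f g : R -> R).

(** Fubini for the two kernels and [f]. Absolute integrability follows by integrating first over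
    [s], where the kernels combine into gk (b + c) by [ge0_gk_semigroup]. *)
Lemma rl_int_comp M b c f t : 0 < b -> 0 < c -> 0 < M -> tame M f ->
  rl_int b (rl_int c f) t = rl_int (b + c) f t.
Proof.
move=> b0 c0 M0 tf; have mf := tame_measurable tf.
have bc0 : 0 < b + c by exact: addr_gt0.
pose H (p : R * R) := (gk b p.1 * gk c (p.2 - p.1) * f (t - p.2))%:E.
have mH : measurable_fun setT H.
  apply/measurable_EFinP; apply: measurable_funM.
    apply: measurable_funM; first exact: measurableT_comp (measurable_gk b) _.
    by apply: measurableT_comp (measurable_gk c) _; exact: measurable_funB.
  by apply: measurableT_comp mf _; exact: measurable_funB.
have iH : (mu \x mu)%E.-integrable setT H.
  apply/integrable21ltyP => //.
  apply: (@le_lt_trans _ _ (\int[mu]_v `|(gk (b + c) v * f (t - v))%:E|)%E); last first.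
    by have /integrableP[_ ] := tame_integrable t bc0 M0 tf.
  rewrite le_eqVlt; apply/orP; left; apply/eqP; apply: eq_integral => v _.
  transitivity (\int[mu]_s (`|f (t - v)|%:E * (gk b s * gk c (v - s))%:E))%E.
    apply: eq_integral => s _; rewrite -EFinM /H abse_EFin normrM ger0_norm ?mulr_ge0 ?gk_ge0//.
    by rewrite [in RHS]mulrC.
  rewrite ge0_integralZl//.
  - by rewrite ge0_gk_semigroup// -EFinM abse_EFin normrM ger0_norm ?gk_ge0// mulrC.
  - by apply/measurable_EFinP/measurable_funM; [exact: measurable_gk|exact: measurable_gk_subr].
  - by move=> s _; rewrite lee_fin mulr_ge0 ?gk_ge0.
have inner s : (gk b s * rl_int c f (t - s))%:E = (\int[mu]_v H (s, v))%E.
  rewrite EFinM (rl_intE _ c0 M0 tf) -integralZl//; last exact: tame_integrable M0 tf.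
  rewrite -[LHS](@integral_addr _ _ (- s)).
    apply: eq_integral => v _; rewrite -EFinM /H/=; congr EFin.
    by rewrite mulrA; congr (_ * f _); ring.
  apply: measurable_funeM; apply/measurable_EFinP; exact: measurable_rl_integrand.
have outer v : (gk (b + c) v * f (t - v))%:E = (\int[mu]_s H (s, v))%E.
  rewrite EFinM muleC -ge0_gk_semigroup// -integralZl//.
    by apply: eq_integral => s _; rewrite -EFinM /H/= mulrC.
  apply/integrableP; split.
    by apply/measurable_EFinP/measurable_funM; [exact: measurable_gk|exact: measurable_gk_subr].
  under eq_integral do rewrite gee0_abs ?lee_fin ?mulr_ge0 ?gk_ge0//.
  by rewrite ge0_gk_semigroup// ltry.
apply: EFin_inj; rewrite (rl_intE _ b0 M0 (tame_rl_int c0 M0 tf)) (rl_intE _ bc0 M0 tf).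
under eq_integral do rewrite inner.
under [RHS]eq_integral do rewrite outer.
exact: Fubini iH.
Qed.

(** The transform is taken over the whole line; for functions vanishing at negative times it is the
    usual one, and a delay becomes a factor without boundary terms. *)
Definition laplace_cvg l f := mu.-integrable setT (fun t => (f t * expR (- (l * t)))%:E).

Definition laplace l f := \int[mu]_t (f t * expR (- (l * t))).

Lemma laplaceE l f : laplace_cvg l f ->
  ((laplace l f)%:E = \int[mu]_t (f t * expR (- (l * t)))%:E)%E.
Proof. by move=> lf; rewrite /laplace /Rintegral fineK// integrable_fin_num. Qed.

Lemma eq_laplace l f g : f =1 g -> laplace l f = laplace l g.
Proof. by move=> fg; apply: eq_Rintegral => t _; rewrite fg. Qed.

Lemma laplace_cvgD l f g : laplace_cvg l f -> laplace_cvg l g ->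
  laplace_cvg l (fun t => f t + g t).
Proof.
move=> lf lg; rewrite /laplace_cvg.
under eq_fun do rewrite mulrDl EFinD.
exact: integrableD.
Qed.

Lemma laplace_cvgZ l k f : laplace_cvg l f -> laplace_cvg l (fun t => k * f t).
Proof.
move=> lf; rewrite /laplace_cvg.
under eq_fun do rewrite -mulrA EFinM.
exact: integrableZl.
Qed.

Lemma laplaceD l f g : laplace_cvg l f -> laplace_cvg l g ->
  laplace l (fun t => f t + g t) = laplace l f + laplace l g.
Proof.
move=> lf lg; rewrite /laplace -RintegralD//.
by apply: eq_Rintegral => t _; rewrite mulrDl.
Qed.

Lemma laplaceZ l k f : laplace_cvg l f -> laplace l (fun t => k * f t) = k * laplace l f.
Proof.
move=> lf; rewrite /laplace -RintegralZl//.
by apply: eq_Rintegral => t _; rewrite mulrA.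
Qed.

Lemma laplace_cvg_measurable l f : laplace_cvg l f ->
  measurable_fun setT (fun t => f t * expR (- (l * t))).
Proof. by move=> /measurable_int/measurable_EFinP. Qed.

Lemma laplace_shift_integrand l d f t :
  f (t - d) * expR (- (l * t)) =
  expR (- (l * d)) * (f (t + - d) * expR (- (l * (t + - d)))).
Proof. by rewrite mulrCA -expRD; congr (_ * expR _); ring. Qed.

Lemma laplace_cvg_shift l d f : laplace_cvg l f -> laplace_cvg l (fun t => f (t - d)).
Proof.
move=> lf; rewrite /laplace_cvg.
under eq_fun do rewrite laplace_shift_integrand EFinM.
apply: integrableZl => //.
have mh := laplace_cvg_measurable lf.
apply/integrableP; split.
  apply/measurable_EFinP.
  apply: (measurableT_comp (f := fun t => f t * expR (- (l * t)))) => //.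
  exact: measurable_addr.
rewrite (ge0_integral_addr (f := fun t => `|(f t * expR (- (l * t)))%:E|%E)).
- by have /integrableP[] := lf.
- by apply: measurableT_comp => //; apply/measurable_EFinP.
- by [].
Qed.

Lemma laplace_shift l d f : laplace_cvg l f ->
  laplace l (fun t => f (t - d)) = expR (- (l * d)) * laplace l f.
Proof.
move=> lf; apply: EFin_inj; rewrite EFinM !laplaceE//; last exact: laplace_cvg_shift.
under eq_integral do rewrite laplace_shift_integrand EFinM.
rewrite (@integral_addr _ (fun t => ((expR (- (l * d)))%:E * (f t * expR (- (l * t)))%:E)%E)).
  by rewrite integralZl.
by apply: measurable_funeM; apply: measurable_int lf.
Qed.

Lemma laplace_cvg_gk l b : 0 < l -> 0 < b -> laplace_cvg l (gk b).
Proof. by move=> l0 b0; exact: integrable_gk. Qed.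

Lemma laplace_gkE l b : 0 < l -> 0 < b -> laplace l (gk b) = l `^ (- b).
Proof. by move=> l0 b0; rewrite /laplace /Rintegral laplace_gk. Qed.

(** The convolution theorem, by Fubini. Convergence at [l] is assumed because the growth rate [M] of
    [f] may exceed [l]; absolute convergence then passes to the fractional integral. *)
Lemma laplace_rl_int M l b f : 0 < l -> 0 < b -> 0 < M -> tame M f -> laplace_cvg l f ->
  laplace_cvg l (rl_int b f) /\ laplace l (rl_int b f) = l `^ (- b) * laplace l f.
Proof.
move=> l0 b0 M0 tf lf; have mf := tame_measurable tf.
pose H (p : R * R) := (gk b p.2 * f (p.1 - p.2) * expR (- (l * p.1)))%:E.
have mH : measurable_fun setT H.
  apply/measurable_EFinP; apply: measurable_funM.
    apply: measurable_funM; first exact: measurableT_comp (measurable_gk b) _.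
    by apply: measurableT_comp mf _; exact: measurable_funB.
  by apply: measurableT_comp (measurable_expRM l) _.
have HE s t : H (t, s) = ((gk b s * expR (- (l * s)))%:E *
    (f (t + - s) * expR (- (l * (t + - s))))%:E)%E.
  rewrite -EFinM /H/=; congr EFin.
  by rewrite mulrACA -expRD; congr (_ * expR _); ring.
have mfl : measurable_fun setT (fun t => (f t * expR (- (l * t)))%:E).
  exact: measurable_int lf.
have iH : (mu \x mu)%E.-integrable setT H.
  apply/integrable21ltyP => //.
  apply: (@le_lt_trans _ _ (\int[mu]_s ((gk b s * expR (- (l * s)))%:E *
     \int[mu]_t `|(f t * expR (- (l * t)))%:E|))%E).
    rewrite le_eqVlt; apply/orP; left; apply/eqP; apply: eq_integral => s _.
    rewrite -(ge0_integral_addr (f := fun t => `|(f t * expR (- (l * t)))%:E|%E) (- s))//; last first.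
      exact: measurableT_comp.
    rewrite -ge0_integralZl//.
    - apply: eq_integral => t _; rewrite HE abseM gee0_abs//.
      by rewrite lee_fin mulr_ge0 ?gk_ge0 ?expR_ge0.
    - apply: measurableT_comp => //.
      exact: measurableT_comp mfl (measurable_addr (- s)).
    - by rewrite lee_fin mulr_ge0 ?gk_ge0 ?expR_ge0.
  have /integrableP[_ L] := lf.
  rewrite ge0_integralZr//.
  - rewrite laplace_gk// lte_mul_pinfty// ?lee_fin ?powR_ge0//.
  - exact: measurable_int (integrable_gk b0 l0).
  - by move=> s _; rewrite lee_fin mulr_ge0 ?gk_ge0 ?expR_ge0.
  - exact: integral_ge0.
have inner t : (rl_int b f t * expR (- (l * t)))%:E = (\int[mu]_s H (t, s))%E.
  rewrite EFinM (rl_intE _ b0 M0 tf) muleC -integralZl//; last exact: tame_integrable M0 tf.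
  by apply: eq_integral => s _; rewrite -EFinM /H/= mulrC.
have outer s : ((gk b s * expR (- (l * s)))%:E * (laplace l f)%:E = \int[mu]_t H (t, s))%E.
  rewrite laplaceE// -(integral_addr (- s))// -integralZl//.
    by apply: eq_integral => t _; rewrite HE.
  have := laplace_cvg_shift s lf; rewrite /laplace_cvg => /(integrableZl measurableT (expR (l * s))).
  apply: eq_integrable => // t _; rewrite laplace_shift_integrand -EFinM [X in X%:E = _]mulrA -expRD.
  by rewrite addrN expR0 mul1r.
split.
  rewrite /laplace_cvg; under eq_fun do rewrite inner.
  exact: integrable_fubini_F iH.
apply: EFin_inj; rewrite EFinM /laplace /Rintegral fineK; last first.
  have := integrable_fin_num measurableT (integrable_fubini_F iH).
  by rewrite /fubini_F; under eq_integral do rewrite -inner.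
under eq_integral do rewrite inner.
rewrite Fubini//.
transitivity (\int[mu]_s ((gk b s * expR (- (l * s)))%:E * (laplace l f)%:E))%E.
  by apply: eq_integral => s _; rewrite outer.
rewrite integralZr//; last exact: integrable_gk.
by rewrite laplace_gk.
Qed.

End rl_composition.

(** * Differentiation of fractional integrals and of their kernels *)

Section rl_derivative.
Context {R : realType}.
Local Notation mu := (@lebesgue_measure R).
Implicit Types (b c t l s u v M C k : R) (f g y z : R -> R).

Lemma Gamma1 : Gamma (1 : R) = 1.
Proof.
apply: EFin_inj; rewrite GammaE// -(@integral_exponential_pdf R 1)//.
rewrite integral_itv_obnd_cbnd; last first.
  by apply/measurable_EFinP; exact: measurable_Gamma_integrand.
rewrite integral_mkcond; apply: eq_integral => t _.
rewrite /exponential_pdf !patchE; case: ifP => // _.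
by rewrite subrr powRr0 !mul1r mulN1r.
Qed.

Lemma gk1E t : 0 < t -> gk 1 t = 1.
Proof. by move=> t0; rewrite gk_gt0E// Gamma1 subrr powRr0 divr1. Qed.

Lemma rl_int_reflect b f t : measurable_fun setT f ->
  rl_int b f t = \int[mu]_u (gk b (t - u) * f u).
Proof.
move=> mf; rewrite rl_int.unlock /Rintegral; congr fine.
rewrite -(@integral_subl _ (fun u => (gk b (t - u) * f u)%:E) t).
  by apply: eq_integral => s _; rewrite subKr.
by apply/measurable_EFinP; apply: measurable_funM => //; exact: measurable_gk_subr.
Qed.

Lemma laplace_cvg_measurable_fun l f : laplace_cvg l f -> measurable_fun setT f.
Proof.
move=> lf; rewrite (_ : f = fun t => f t * expR (- (l * t)) * expR (l * t)).
  apply: measurable_funM; first exact: laplace_cvg_measurable.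
  by apply: measurableT_comp => //; exact: measurable_funM.
by apply/funext => t; rewrite -mulrA -expRD addNr expR0 mulr1.
Qed.

(** For t <= u the weight exp(- l t) is at least exp(- l u), so it can be divided out. *)
Lemma laplace_cvg_local l f u : 0 < l -> laplace_cvg l f ->
  mu.-integrable `]-oo, u] (EFin \o f).
Proof.
move=> l0 lf; have mf := laplace_cvg_measurable_fun lf.
apply: (@le_integrable _ _ _ mu _ _ _
   (fun t => ((expR (l * u))%:E * (f t * expR (- (l * t)))%:E)%E)) => //.
- by apply/measurable_EFinP; exact: measurable_funTS.
- move=> t /=; rewrite in_itv/= => tu.
  rewrite lee_fin !normrM mulrCA ler_peMr// !(@ger0_norm _ (expR _)) ?expR_ge0//.
  by rewrite -expRD -expR0 ler_expR subr_ge0 ler_pM2l.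
- by apply: integrableZl => //; apply: integrableS lf.
Qed.

Lemma rl_int1E f t : measurable_fun setT f ->
  rl_int 1 f t = \int[mu]_(u in `]-oo, t]) f u.
Proof.
move=> mf; have -> : \int[mu]_(u in `]-oo, t]) f u = \int[mu]_(u in `]-oo, t[) f u.
  rewrite /Rintegral integral_itv_bndo_bndc//.
  by apply/measurable_EFinP; exact: measurable_funTS.
rewrite rl_int_reflect// [RHS]Rintegral_mkcond; apply: eq_Rintegral => u _.
rewrite patchE mem_setE in_itv/=; case: ltP => ut; first by rewrite gk1E ?subr_gt0// mul1r.
by rewrite gk_le0E ?mul0r// subr_le0.
Qed.

(** [rl_int 1 f] is the primitive of [f] from minus infinity. Continuity is asked at [t] alone, so
    that kernels singular at 0 are covered. *)
Lemma is_derive_rl_int1 l f t : 0 < l -> laplace_cvg l f -> {for t, continuous f} ->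
  is_derive t 1 (rl_int 1 f) (f t).
Proof.
move=> l0 lf cf; have mf := laplace_cvg_measurable_fun lf.
have -> : rl_int 1 f = fun x => \int[mu]_(u in `]-oo, x]) f u.
  by apply/funext => x; rewrite rl_int1E.
have tt1 : t < t + 1 by rewrite ltrDl.
have := continuous_FTC1 tt1 (laplace_cvg_local (t + 1) l0 lf).
move=> /(_ _ cf)[|dF F't]; first by rewrite ltNyr.
by rewrite -F't derive1E; exact: derivableP.
Qed.

(** Since [gk 1] is the indicator of the positive half-line, the dominating function is a one-sided
    exponential of rate l - M. *)
Lemma tame_laplace_cvg M l f : M < l -> tame M f -> laplace_cvg l f.
Proof.
move=> Ml tf; have [C fC] := tame_bound tf.
have lM0 : 0 < l - M by rewrite subr_gt0.
apply: (@le_integrable _ _ _ mu setT measurableT _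
  (fun t => (C%:E * (gk 1 t * expR (- ((l - M) * t)))%:E)%E)).
- apply/measurable_EFinP; apply: measurable_funM; first exact: tame_measurable tf.
  exact: measurable_expRM.
- move=> t _; rewrite -EFinM lee_fin; have [t0|t0] := ltP 0 t; last first.
    by rewrite (tame_le0 tf)// mul0r normr0.
  rewrite gk1E// mul1r [leRHS]ger0_norm ?mulr_ge0 ?(exp_bound_ge0 fC) ?expR_ge0//.
  rewrite normrM [X in _ * X]ger0_norm ?expR_ge0//.
  rewrite (_ : - ((l - M) * t) = M * t + - (l * t)); last by ring.
  by rewrite expRD mulrA ler_wpM2r ?expR_ge0//; exact: fC.
- by apply: integrableZl => //; exact: integrable_gk.
Qed.

Lemma continuous_gk b t : 0 < t -> {for t, continuous (gk b : R -> R)}.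
Proof.
move=> t0.
have E : \forall s \near t, s `^ (b - 1) / Gamma b = gk b s.
  by near=> s; rewrite gk_gt0E//; near: s; exact: lt_nbhsr.
apply: (cvg_trans (near_eq_cvg E)).
rewrite gk_gt0E//; apply: cvgM; last exact: cvg_cst.
exact: continuous_powR_gt0.
Unshelve. end_near. Qed.

(** By the semigroup law gk (b + 1) is the primitive of gk b, so the fundamental theorem gives the
    derivative and takes the place of Gamma(b + 1) = b Gamma(b). *)
Lemma is_derive_gk b t : 0 < b -> 0 < t -> is_derive t 1 (gk (b + 1)) (gk b t).
Proof.
move=> b0 t0.
have -> : gk (b + 1) = rl_int 1 (gk b) :> (R -> R).
  by apply/funext => s; rewrite rl_int_gk// addrC.
by apply: (is_derive_rl_int1 (l := 1)) => //; [exact: laplace_cvg_gk|exact: continuous_gk].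
Qed.

Lemma is_derive_rl_int M b f t : 0 < b -> 0 < M -> tame M f ->
  is_derive t 1 (rl_int (b + 1) f) (rl_int b f t).
Proof.
move=> b0 M0 tf.
have -> : rl_int (b + 1) f = rl_int 1 (rl_int b f).
  by apply/funext => s; rewrite (rl_int_comp _ _ _ M0 tf)// addrC.
apply: (is_derive_rl_int1 (l := M + 1)).
- by rewrite addr_gt0.
- apply: (@tame_laplace_cvg M); first by rewrite ltrDl.
  exact: tame_rl_int.
- exact: (tame_continuous (tame_rl_int b0 M0 tf)).
Qed.

Lemma tame_is_derive_rl_int1 M f t : 0 < M -> tame M f -> is_derive t 1 (rl_int 1 f) (f t).
Proof.
move=> M0 tf; apply: (is_derive_rl_int1 (l := M + 1)).
- by rewrite addr_gt0.
- by apply: (@tame_laplace_cvg M) => //; rewrite ltrDl.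
- exact: (tame_continuous tf).
Qed.

End rl_derivative.

(** * Caputo derivatives *)

Section caputo_rl.
Context {R : realType}.
Local Notation mu := (@lebesgue_measure R).
Implicit Types (b c t l s u v M C k m : R) (f g w x y z : R -> R).

Lemma rl_cvgD b f g : rl_cvg b f -> rl_cvg b g -> rl_cvg b (fun t => f t + g t).
Proof.
move=> bf bg t; under eq_fun do rewrite mulrDr EFinD.
exact: integrableD (bf t) (bg t).
Qed.

Lemma rl_cvgZ b k f : rl_cvg b f -> rl_cvg b (fun t => k * f t).
Proof.
move=> bf t; under eq_fun do rewrite mulrCA EFinM.
exact: integrableZl (bf t).
Qed.

Lemma rl_cvg_gk b c : 0 < b -> 0 < c -> rl_cvg b (gk c).
Proof.
move=> b0 c0 t; apply/integrableP; split.
  by apply/measurable_EFinP/measurable_funM; [exact: measurable_gk|exact: measurable_gk_subr].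
under eq_integral do rewrite gee0_abs ?lee_fin ?mulr_ge0 ?gk_ge0//.
by rewrite ge0_gk_semigroup// ltry.
Qed.

Lemma integrable_subl (h : R -> R) t : mu.-integrable setT (EFin \o h) ->
  mu.-integrable setT (fun u => (h (t - u))%:E).
Proof.
move=> ih; have mh : measurable_fun setT (EFin \o h) by exact: measurable_int ih.
apply/integrableP; split.
  by apply: (measurableT_comp (f := EFin \o h)) => //; exact: measurable_subl.
rewrite (@ge0_integral_subl _ (fun u => `|(h u)%:E|%E))//.
  by have /integrableP[] := ih.
exact: measurableT_comp mh.
Qed.

Lemma caputo_integrandE (n : nat) m f w t : caputo_order m = n -> m < n%:R ->
  (forall s, 0 < s -> derive1n n f s = w s) ->
  {in `]0, t[%classic, caputo_integrand m f t =1
     (fun s => Gamma (n%:R - m) * (gk (n%:R - m) (t - s) * w s))}.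
Proof.
move=> mn mltn fw s; rewrite inE/= in_itv/= => /andP[s0 st].
rewrite /caputo_integrand mn fw// gk_gt0E ?subr_gt0// mulrA; congr (_ * _).
by rewrite [RHS]mulrC divfK// gt_eqF// Gamma_gt0// subr_gt0.
Qed.

Lemma rl_cvg_reflect b w t : rl_cvg b w ->
  mu.-integrable setT (fun s => (gk b (t - s) * w s)%:E).
Proof.
move=> bw; have := integrable_subl t (bw t).
by apply: eq_integrable => // s _; rewrite subKr.
Qed.

Lemma caputo_integrable (n : nat) m f w t : caputo_order m = n -> m < n%:R ->
  (forall s, 0 < s -> derive1n n f s = w s) -> rl_cvg (n%:R - m) w ->
  mu.-integrable `]0, t[ (fun s => (caputo_integrand m f t s)%:E).
Proof.
move=> mn mltn fw bw.
apply: (@eq_integrable _ _ _ mu _ _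
  (fun s => ((Gamma (n%:R - m))%:E * (gk (n%:R - m) (t - s) * w s)%:E)%E)) => //.
  by move=> s st; rewrite (caputo_integrandE mn mltn fw)// EFinM.
by apply: integrableZl => //; apply: integrableS (rl_cvg_reflect t bw).
Qed.

(** Continued by zero to s <= 0, the derivative of order [n] turns the Caputo integral over ]0, t[
    into a convolution over the line, and the normalising factor is the one built into [gk]. *)
Lemma caputoE (n : nat) m f w t : caputo_order m = n -> m < n%:R ->
  (forall s, 0 < s -> derive1n n f s = w s) -> (forall s, s <= 0 -> w s = 0) ->
  measurable_fun setT w -> rl_cvg (n%:R - m) w ->
  caputo m f t = rl_int (n%:R - m) w t.
Proof.
move=> mn mltn fw w0 mw bw.
have E := @eq_Rintegral _ _ _ mu _ _ _ (caputo_integrandE mn mltn fw (t := t)).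
rewrite /caputo mn lt_eqF// E.
rewrite RintegralZl//; last by apply: integrableS (rl_cvg_reflect t bw).
rewrite mulrA mulVf ?mul1r; last by rewrite gt_eqF// Gamma_gt0// subr_gt0.
rewrite rl_int_reflect// Rintegral_mkcond; apply: eq_Rintegral => s _.
rewrite patchE mem_setE in_itv/=; case: ltP => s0 /=; last by rewrite w0// mulr0.
by case: ltP => // st; rewrite gk_le0E ?mul0r// subr_le0.
Qed.

Lemma caputo_order1 m : 0 < m <= 1 -> caputo_order m = 1%N.
Proof. by move=> h; rewrite /caputo_order (@ceil_def _ _ 1)// subrr. Qed.

Lemma caputo_order2 m : 1 < m <= 2 -> caputo_order m = 2%N.
Proof. by move=> h; rewrite /caputo_order (@ceil_def _ _ 2). Qed.

Lemma is_derive_pos f g t k : (forall s, 0 < s -> f s = g s) -> 0 < t ->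
  is_derive t 1 g k -> is_derive t 1 f k.
Proof.
move=> fg t0; apply: near_eq_is_derive; near=> s; rewrite fg//.
by near: s; exact: lt_nbhsr.
Unshelve. end_near. Qed.

Definition gk_sum (n : nat) (e beta : nat -> R) t := \sum_(i < n) e i * gk (beta i) t.

Lemma gk_sumS n (e beta : nat -> R) :
  gk_sum n.+1 e beta = fun t => gk_sum n e beta t + e n * gk (beta n) t.
Proof. by apply/funext => t; rewrite /gk_sum big_ord_recr. Qed.

Lemma gk_sum0 (e beta : nat -> R) : gk_sum 0 e beta = cst 0.
Proof. by apply/funext => t; rewrite /gk_sum big_ord0. Qed.

Lemma gk_sum_le0 n (e beta : nat -> R) t : t <= 0 -> gk_sum n e beta t = 0.
Proof. by move=> t0; apply: big1 => i _; rewrite gk_le0E ?mulr0. Qed.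

Lemma is_derive_gk_sum n (e beta : nat -> R) t : 0 < t -> (forall i, 0 < beta i) ->
  is_derive t 1 (gk_sum n e (fun i => beta i + 1)) (gk_sum n e beta t).
Proof.
move=> t0 b0; elim: n => [|n IHn]; first by rewrite !gk_sum0; exact: is_derive_cst.
rewrite !gk_sumS; apply: is_deriveD.
apply: is_deriveZ; exact: is_derive_gk.
Qed.

Lemma measurable_gk_sum n (e beta : nat -> R) : measurable_fun setT (gk_sum n e beta).
Proof.
elim: n => [|n IHn]; first by rewrite gk_sum0.
by rewrite gk_sumS; apply: measurable_funD => //; apply: measurable_funM => //; exact: measurable_gk.
Qed.

Lemma rl_cvg_gk_sum n (e beta : nat -> R) b : 0 < b -> (forall i, 0 < beta i) ->
  rl_cvg b (gk_sum n e beta).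
Proof.
move=> b0 be0; elim: n => [|n IHn].
  rewrite gk_sum0 => t; under eq_fun do rewrite mulr0.
  exact: integrable0.
by rewrite gk_sumS; apply: rl_cvgD => //; apply: rl_cvgZ; exact: rl_cvg_gk.
Qed.

Lemma rl_int_gk_sum n (e beta : nat -> R) b t : 0 < b -> (forall i, 0 < beta i) ->
  rl_int b (gk_sum n e beta) t = gk_sum n e (fun i => beta i + b) t.
Proof.
move=> b0 be0; elim: n => [|n IHn].
  by rewrite !gk_sum0 rl_int.unlock /Rintegral integral0_eq// => s _; rewrite mulr0.
rewrite !gk_sumS rl_cvg_intD; last 2 first.
- exact: rl_cvg_gk_sum.
- by apply: rl_cvgZ; exact: rl_cvg_gk.
rewrite IHn rl_cvg_intZ; last exact: rl_cvg_gk.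
by rewrite rl_int_gk// [b + _]addrC.
Qed.

Lemma laplace_cvg_gk_sum n (e beta : nat -> R) l : 0 < l -> (forall i, 0 < beta i) ->
  laplace_cvg l (gk_sum n e beta).
Proof.
move=> l0 be0; elim: n => [|n IHn].
  rewrite gk_sum0 /laplace_cvg; under eq_fun do rewrite mul0r.
  exact: integrable0.
by rewrite gk_sumS; apply: laplace_cvgD => //; apply: laplace_cvgZ; exact: laplace_cvg_gk.
Qed.

(** * Caputo derivatives of a constant plus powers plus a second integral *)

Section caputo_expansion.
Variables (n : nat) (e beta : nat -> R) (k M : R) (r x : R -> R).
Hypotheses (M0 : 0 < M) (tr : tame M r) (beta0 : forall i, 0 < beta i).
Hypothesis xE : forall t, 0 < t ->
  x t = k + gk_sum n e (fun i => beta i + 1) t + rl_int 2 r t.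

Let x1 t := gk_sum n e beta t + rl_int 1 r t.

Lemma is_derive_expansion t : 0 < t -> is_derive t 1 x (x1 t).
Proof.
move=> t0; apply: (is_derive_pos xE t0).
rewrite /x1 -[gk_sum _ _ _ _]add0r.
apply: is_deriveD; first by apply: is_deriveD; exact: is_derive_gk_sum.
by have := @is_derive_rl_int R M 1 r t ltr01 M0 tr.
Qed.

Let derive1x s : 0 < s -> derive1n 1 x s = x1 s.
Proof. by move=> /is_derive_expansion [_ <-]; rewrite derive1n1 derive1E. Qed.

Let mx1 : measurable_fun setT x1.
Proof.
apply: measurable_funD; first exact: measurable_gk_sum.
exact: tame_measurable (tame_rl_int ltr01 M0 tr).
Qed.

Let x1_le0 s : s <= 0 -> x1 s = 0.
Proof.
move=> s0; rewrite /x1 gk_sum_le0// add0r rl_int_le0//; exact: tame_le0 tr.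
Qed.

Let rl_cvg_x1 b : 0 < b -> rl_cvg b x1.
Proof.
move=> b0; apply: rl_cvgD; first exact: rl_cvg_gk_sum.
by apply: (rl_cvg_tame b0 M0); exact: tame_rl_int.
Qed.

Lemma caputo_exists_expansion1 m : 0 < m <= 1 -> caputo_exists m x.
Proof.
move=> m01; have mo := caputo_order1 m01; rewrite /caputo_exists mo; split.
  by move=> [|//] t _ t0; have [] := is_derive_expansion t0.
move=> m1 t t0; have m_lt1 : m < 1%:R by rewrite lt_neqAle m1; case/andP: m01.
by apply: (caputo_integrable _ mo m_lt1 derive1x); apply: rl_cvg_x1; rewrite subr_gt0.
Qed.

(** For m < 1 this is the integral of order 1 - m of [x1], so every order drops by [m]. The formula
    has the same form for 1 < m < 2 in [caputo_expansion2]. *)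
Lemma caputo_expansion1 m t : 0 < m <= 1 -> 0 < t ->
  caputo m x t = gk_sum n e (fun i => beta i + 1 - m) t + rl_int (2 - m) r t.
Proof.
move=> m01 t0; have mo := caputo_order1 m01.
(* At m = 1 [caputo] is by definition the plain derivative; this case is met when 2 alpha = 1. *)
have [m1|m1] := eqVneq m 1.
  rewrite /caputo mo m1 eqxx derive1x// /x1 (_ : 2 - 1 = 1 :> R); last by lra.
  by congr (_ + _); apply: eq_bigr => i _; rewrite addrK.
have m_lt1 : m < 1%:R by rewrite lt_neqAle m1; case/andP: m01.
have m0 : 0 < 1%:R - m by rewrite subr_gt0.
rewrite (caputoE _ mo m_lt1 derive1x)//; last exact: rl_cvg_x1.
rewrite rl_cvg_intD; last 2 first.
- exact: rl_cvg_gk_sum.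
- by apply: (rl_cvg_tame m0 M0); exact: tame_rl_int.
rewrite rl_int_gk_sum// (rl_int_comp _ m0 ltr01 M0 tr); congr (_ + rl_int _ _ _); last by lra.
by apply: eq_bigr => i _; rewrite addrA.
Qed.

Hypothesis beta1 : forall i, 1 < beta i.

Let x2 t := gk_sum n e (fun i => beta i - 1) t + r t.

Let beta10 i : 0 < beta i - 1. Proof. by rewrite subr_gt0. Qed.

(** [beta1] keeps the orders beta i - 1 positive, so that the second derivative remains integrable
    at 0. *)
Lemma is_derive_expansion2 t : 0 < t -> is_derive t 1 x1 (x2 t).
Proof.
move=> t0; apply: is_deriveD; last exact: tame_is_derive_rl_int1 M0 tr.
have -> : beta = (fun i => (beta i - 1) + 1) by apply/funext => i; rewrite subrK.
under [X in gk_sum _ _ X t]eq_fun do rewrite addrK.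
exact: is_derive_gk_sum.
Qed.

Let derive2x s : 0 < s -> derive1n 2 x s = x2 s.
Proof.
move=> s0; rewrite derive1nS derive1E.
have [_ <-] : is_derive s 1 (derive1n 1 x) (x2 s) by
  apply: (is_derive_pos derive1x s0); exact: is_derive_expansion2.
by [].
Qed.

Let rl_cvg_x2 b : 0 < b -> rl_cvg b x2.
Proof.
by move=> b0; apply: rl_cvgD; [exact: rl_cvg_gk_sum|exact: rl_cvg_tame M0 tr].
Qed.

Lemma caputo_exists_expansion2 m : 1 < m < 2 -> caputo_exists m x.
Proof.
move=> /andP[m1 m2]; have mo := @caputo_order2 m ltac:(by rewrite m1 ltW).
rewrite /caputo_exists mo; split.
  move=> [|[|//]] t _ t0; first by have [] := is_derive_expansion t0.
  by have [] : is_derive t 1 (derive1n 1 x) (x2 t) by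
    apply: (is_derive_pos derive1x t0); exact: is_derive_expansion2.
move=> _ t t0.
by apply: (caputo_integrable _ mo m2 derive2x); apply: rl_cvg_x2; rewrite subr_gt0.
Qed.

Lemma caputo_expansion2 m t : 1 < m < 2 -> 0 < t ->
  caputo m x t = gk_sum n e (fun i => beta i + 1 - m) t + rl_int (2 - m) r t.
Proof.
move=> /andP[m1 m2] t0; have mo := @caputo_order2 m ltac:(by rewrite m1 ltW).
have m20 : 0 < 2%:R - m by rewrite subr_gt0.
rewrite (caputoE _ mo m2 derive2x); last 3 first.
- by move=> s s0; rewrite /x2 gk_sum_le0// (tame_le0 tr)// addr0.
- by apply: measurable_funD; [exact: measurable_gk_sum|exact: tame_measurable tr].
- exact: rl_cvg_x2.
rewrite rl_cvg_intD; last 2 first.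
- exact: rl_cvg_gk_sum.
- exact: rl_cvg_tame M0 tr.
rewrite rl_int_gk_sum//; congr (_ + _).
by apply: eq_bigr => i _; congr (_ * gk _ _); lra.
Qed.

End caputo_expansion.

End caputo_rl.

(** * Volterra equations *)

Section neumann_series.
Context {R : realType}.
Variables (M q : R) (T : (R -> R) -> R -> R) (F : R -> R).
Hypothesis q01 : 0 <= q < 1.
Hypothesis tameT : forall f, tame M f -> tame M (T f).
Hypothesis TD : forall f g, tame M f -> tame M g ->
  T (fun t => f t + g t) = fun t => T f t + T g t.
Hypothesis contractT : forall C f, tame M f -> exp_bound M C f -> exp_bound M (C * q) (T f).
Hypothesis tameF : tame M F.

Let Fk (k : nat) := iter k T F.

Let tameFk k : tame M (Fk k).
Proof. by elim: k => [//|k IHk]; exact: tameT. Qed.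

Let S (n : nat) t := \sum_(k < n) Fk k t.

Let SS n : S n.+1 = fun t => S n t + Fk n t.
Proof. by apply/funext => t; rewrite /S big_ord_recr. Qed.

Let tameS n : tame M (S n).
Proof.
elim: n => [|n IHn]; last by rewrite SS; exact: tameD.
by rewrite (_ : S 0 = cst 0); [exact: tame0|apply/funext => t; rewrite /S big_ord0].
Qed.

Let T0 : T (cst 0) = cst 0.
Proof.
apply/funext => t /=.
have /(congr1 (@^~ t)) /= := TD (tame0 M) (tame0 M).
rewrite (_ : (fun _ => _) = cst (0 : R)); last by apply/funext => s; rewrite /cst addr0.
by move=> h; apply: (@addrI _ (T (cst 0) t)); rewrite addr0 -h.
Qed.

Let TS n t : F t + T (S n) t = S n.+1 t.
Proof.
elim: n => [|n IHn].
  rewrite (_ : S 0 = cst 0); last by apply/funext => s; rewrite /S big_ord0.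
  by rewrite T0/= addr0 /S big_ord_recr big_ord0/= add0r.
by rewrite {1}SS TD// addrA IHn [in RHS]SS.
Qed.

(** The solution is the sum of the iterates of [T] on [F], whose weighted norms decay like q^k. *)
Lemma neumann_series : exists r, tame M r /\ forall t, r t = F t + T r t.
Proof.
have /andP[q0 q1] := q01; have [C FC] := tame_bound tameF.
have C0 := exp_bound_ge0 FC.
have FkC k : exp_bound M (C * q ^+ k) (Fk k).
  elim: k => [|k IHk]; first by rewrite expr0 mulr1.
  by rewrite exprSr mulrA; exact: contractT.
have q10 : 0 < 1 - q by rewrite subr_gt0.
(* [K * q ^+ n] is the sum of the geometric tail C q^k over k >= n. *)
pose K := C / (1 - q); have K0 : 0 <= K by rewrite divr_ge0// ltW.
have Kn0 n : 0 <= K * q ^+ n := mulr_ge0 K0 (exprn_ge0 n q0).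
(* The factor 1 - q^m closes the induction on [m] with equality, because C = K (1 - q). *)
have gap n m t : `|S (n + m)%N t - S n t| <= K * q ^+ n * (1 - q ^+ m) * expR (M * t).
  elim: m => [|m IHm]; first by rewrite addn0 subrr normr0 expr0 subrr mulr0 mul0r.
  rewrite addnS SS addrAC (le_trans (ler_normD _ _))//.
  apply: (le_trans (lerD IHm (FkC _ _))); rewrite -mulrDl ler_pM2r ?expR_gt0//.
  rewrite -subr_ge0 (_ : _ - _ = 0)// exprD exprS /K; field; exact: lt0r_neq0.
have gap' n m t : (n <= m)%N -> `|S m t - S n t| <= K * q ^+ n * expR (M * t).
  move=> nm; rewrite -(subnKC nm) (le_trans (gap _ _ _))// ler_pM2r ?expR_gt0//.
  apply: ler_piMr; first exact: Kn0.
  by rewrite gerBl exprn_ge0.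
have cvgS t : cvgn (S ^~ t).
  rewrite (_ : S ^~ t = series (fun k => Fk k t)); last first.
    by apply/funext => n; rewrite /S /series/= big_mkord.
  apply: normed_cvg.
  apply: (@series_le_cvg _ _ (geometric (C * expR (M * t)) q)) => [n|n|n|].
  - exact: normr_ge0.
  - by rewrite /geometric/= !mulr_ge0 ?expR_ge0 ?exprn_ge0.
  - by rewrite /geometric/= mulrAC; exact: FkC.
  - by apply: is_cvg_geometric_series; rewrite ger0_norm.
pose r t := limn (S ^~ t).
have tail n t : `|r t - S n t| <= K * q ^+ n * expR (M * t).
  have c : (fun m => `|S m t - S n t|) @ \oo --> `|r t - S n t|.
    apply: cvg_norm; apply: cvgB; last exact: cvg_cst.
    exact: cvgS.
  rewrite -(cvg_lim _ c)//; apply: limr_le; first exact: cvgP c.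
  by exists n => // m /= nm; exact: gap'.
have Kq c : 0 < c -> exists n, K * q ^+ n < c.
  move=> c0; have : (fun n => K * q ^+ n) @ \oo --> (0 : R).
    rewrite -(mulr0 K); apply: cvgM; first exact: cvg_cst.
    by apply: cvg_expr; rewrite ger0_norm.
  move=> /cvgrPdist_lt /(_ _ c0) [N _ /(_ N (leqnn N))] /=.
  rewrite sub0r normrN ger0_norm ?Kn0// => ?.
  by exists N.
have tr : tame M r.
  split.
  (* The weight makes the convergence only locally uniform: an eps / 3 argument on a neighbourhood
     where exp(M s) <= [E]. *)
  - move=> t; apply/cvgrPdist_lt => /= eps eps0.
    pose E := expR (M * t) + 1.
    have E0 : 0 < E by rewrite addr_gt0 ?expR_gt0.
    have [n nE] := Kq (eps / (3 * E)) ltac:(by rewrite divr_gt0// mulr_gt0).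
    have cE : continuous (fun s => expR (M * s)).
      move=> s; apply: continuous_comp; last exact: continuous_expR.
      by apply: cvgM => //; exact: cvg_cst.
    have eps3 : 0 < eps / 3 by rewrite divr_gt0.
    have KE s : expR (M * s) <= E -> `|r s - S n s| < eps / 3.
      move=> sE; apply: (le_lt_trans (tail n s)).
      apply: (@le_lt_trans _ _ (K * q ^+ n * E)).
        by rewrite ler_wpM2l ?Kn0.
      have : K * q ^+ n * (3 * E) < eps by rewrite -ltr_pdivlMr ?mulr_gt0.
      lra.
    have cS : continuous (S n) := tame_continuous (tameS n).
    near=> s.
    have sE : expR (M * s) <= E.
      near: s; move/cvgrPdist_lt: (cE t) => /(_ 1 ltr01); apply: filterS => s /= hs.
      by move: hs; rewrite ltr_norml => /andP[h _]; rewrite /E; lra.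
    have SE : `|S n t - S n s| < eps / 3.
      by near: s; move/cvgrPdist_lt: (cS t) => /(_ _ eps3).
    have rt := KE t ltac:(by rewrite /E lerDl).
    have rs := KE s sE.
    rewrite (_ : r t - r s = (r t - S n t) + (S n t - S n s) - (r s - S n s)); last by ring.
    apply: (le_lt_trans (ler_normB _ _)).
    have := ler_normD (r t - S n t) (S n t - S n s).
    lra.
  - move=> t t0; rewrite /r (_ : S ^~ t = cst 0) ?lim_cst//.
    by apply/funext => n /=; rewrite (tame_le0 (tameS n)).
  - exists K => t; have := tail 0%N t.
    by rewrite expr0 mulr1 /S big_ord0 subr0.
exists r; split=> // t.
(* The residual of [r] equals (r - S (n + 1)) - T (r - S n), of size at most 2 K q^n exp(M t) for
   every [n], hence zero. *)
apply/eqP; rewrite -subr_eq0 -normr_eq0 eq_le normr_ge0 andbT.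
apply/ler_addgt0Pl => eps eps0; rewrite addr0.
have [n nE] := Kq (eps / (2 * expR (M * t))) ltac:(by rewrite divr_gt0// mulr_gt0// expR_gt0).
pose d s := r s + -1 * S n s.
have td : tame M d by apply: tameD => //; exact: tameZ.
have rE : r = fun s => S n s + d s by apply/funext => s; rewrite /d; ring.
have dB : exp_bound M (K * q ^+ n) d by move=> s; rewrite /d mulN1r; exact: tail.
have TdB := contractT td dB.
have -> : r t - (F t + T r t) = (r t - S n.+1 t) - T d t.
  by rewrite [in T r]rE TD// -TS; ring.
rewrite (le_trans (ler_normB _ _))//.
apply: (le_trans (lerD (tail n.+1 t) (TdB t))).
rewrite exprSr mulrA -mulrDl.
have h : K * q ^+ n * q <= K * q ^+ n by apply: ler_piMr; [exact: Kn0|exact: ltW].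
apply: (@le_trans _ _ (2 * (K * q ^+ n) * expR (M * t))).
  by rewrite ler_pM2r ?expR_gt0//; lra.
by move: nE; rewrite ltr_pdivlMr ?mulr_gt0 ?expR_gt0// => /ltW; rewrite [_ * (2 * _)]mulrCA mulrA.
Unshelve. all: by end_near. Qed.

End neumann_series.

(** * The Volterra operator of the delay equation *)

Section volterra.
Context {R : realType}.
Implicit Types (b t M al tau p q d : R) (f F r : R -> R).

Lemma continuous_gk_gt1 b : 1 < b -> continuous (gk b : R -> R).
Proof.
move=> b1 t; have [t0|t0|->] := ltgtP t 0; last 1 first.
- apply/left_right_continuousP; rewrite gk_le0E//; split.
    have E : \forall s \near 0^'-, (0 : R) = gk b s.
      by near=> s; rewrite gk_le0E//; near: s; exact: nbhs_left_le.
    by apply: (cvg_trans (near_eq_cvg E)); exact: cvg_cst.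
  have c : (fun s : R => s `^ (b - 1) / Gamma b) @ 0^'+ --> (0 : R).
    rewrite -[X in _ --> X](mul0r (Gamma b)^-1).
    apply: cvgM; last exact: cvg_cst.
    by apply: powR_cvg0; rewrite subr_gt0.
  have E : \forall s \near 0^'+, s `^ (b - 1) / Gamma b = gk b s.
    by near=> s; rewrite gk_gt0E.
  exact: (cvg_trans (near_eq_cvg E)).
- have E : \forall s \near t, (0 : R) = gk b s.
    by near=> s; rewrite gk_le0E//; near: s; apply: filterS (lt_nbhsl t0) => s /ltW.
  by apply: (cvg_trans (near_eq_cvg E)); rewrite gk_le0E ?ltW//; exact: cvg_cst.
- exact: continuous_gk.
Unshelve. all: by end_near. Qed.

(** With k = b - 1, the inequality ln y < y at y = t M / k gives t^k <= (k / M)^k exp(M t). *)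
Lemma tame_gk b M : 1 < b -> 0 < M -> tame M (gk b).
Proof.
move=> b1 M0; split.
- exact: continuous_gk_gt1.
- by move=> t; exact: gk_le0E.
- pose k := b - 1; have k0 : 0 < k by rewrite subr_gt0.
  have G0 : 0 < Gamma b by apply: Gamma_gt0; lra.
  exists (expR (- (k * ln (M / k))) / Gamma b) => t.
  have [t0|t0] := ltP 0 t; last first.
    by rewrite gk_le0E// normr0 mulr_ge0 ?divr_ge0 ?expR_ge0// ltW.
  rewrite ger0_norm; last by rewrite gk_ge0//; lra.
  rewrite gk_gt0E// mulrAC ler_pM2r ?invr_gt0// -/k -expRD /powR gt_eqF// ler_expR.
  have Mk0 : 0 < M / k by rewrite divr_gt0.
  have := @ln_sublinear _ (t * (M / k)) (mulr_gt0 t0 Mk0).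
  rewrite lnM ?posrE// -(ltr_pM2l k0) mulrDr => h.
  have E : k * (t * (M / k)) = M * t by field; exact: lt0r_neq0.
  move: h; rewrite E; lra.
Qed.

Definition volterra_op al tau p q d f t : R :=
  p * rl_int al f t + (q * rl_int (al + al) f t + d * rl_int (al + al) f (t - tau)).

(** [M] is fixed before [F], since the forcing term is chosen later and must be tame for the same
    [M]. *)
Lemma volterra_solution al tau p q d : 0 < al -> 0 <= tau ->
  exists2 M, 0 < M & forall F, tame M F ->
    exists r, tame M r /\ forall t, r t = F t + volterra_op al tau p q d r t.
Proof.
move=> al0 tau0.
pose eps := (2 * (1 + `|p| + `|q| + `|d|))^-1.
have N0 : 1 <= 1 + `|p| + `|q| + `|d|.
  by have := normr_ge0 p; have := normr_ge0 q; have := normr_ge0 d; lra.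
have N0' : 0 < 2 * (1 + `|p| + `|q| + `|d|) by lra.
have eps0 : 0 < eps by rewrite invr_gt0.
have eps1 : eps <= 1 by rewrite invf_le1//; lra.
(* With this [M] both M^(- al) and M^(- 2 al) are at most [eps], so the operator has weighted norm
   at most (|p| + |q| + |d|) eps <= 1/2. *)
pose M := eps `^ (- al^-1).
have M0 : 0 < M by exact: powR_gt0.
have Mal : M `^ (- al) = eps.
  by rewrite -powRrM mulrNN mulVf ?gt_eqF// powRr1// ltW.
have Mal2 : M `^ (- (al + al)) <= eps.
  rewrite opprD powRD; last by rewrite (gt_eqF M0) implybT.
  by rewrite Mal ler_piMr// ltW.
have al2 : 0 < al + al by exact: addr_gt0.
exists M => // F tF.
apply: (@neumann_series _ M 2^-1) => //.
- by apply/andP; split; lra.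
- move=> f tf; apply: tameD; first by apply: tameZ; exact: tame_rl_int.
  apply: tameD; first by apply: tameZ; exact: tame_rl_int.
  by apply: tameZ; apply: tame_shift => //; exact: tame_rl_int.
- move=> f g tf tg; apply/funext => t; rewrite /volterra_op.
  by rewrite !(rl_intD _ _ M0 tf tg)//; ring.
- move=> C f tf fC t.
  have C0 := exp_bound_ge0 fC.
  have B1 := rl_int_bound al0 M0 tf fC t.
  have B2 := rl_int_bound al2 M0 tf fC t.
  (* The delay only decreases the weight: exp(M (t - tau)) <= exp(M t). *)
  have B3 : `|rl_int (al + al) f (t - tau)| <= C * eps * expR (M * t).
    apply: (le_trans (rl_int_bound al2 M0 tf fC (t - tau))).
    apply: ler_pM; rewrite ?mulr_ge0 ?powR_ge0 ?expR_ge0 ?ler_wpM2l//.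
    by rewrite ler_expR ler_pM2l// gerBl.
  have B2' : `|rl_int (al + al) f t| <= C * eps * expR (M * t).
    by apply: (le_trans B2); rewrite ler_pM2r ?expR_gt0// ler_wpM2l.
  rewrite Mal in B1.
  pose X := C * eps * expR (M * t).
  have X0 : 0 <= X by rewrite !mulr_ge0 ?expR_ge0// ltW.
  apply: (@le_trans _ _ (`|p| * X + (`|q| * X + `|d| * X))).
    rewrite /volterra_op (le_trans (ler_normD _ _))// lerD ?normrM ?ler_wpM2l//.
    by rewrite (le_trans (ler_normD _ _))// lerD ?normrM ?ler_wpM2l.
  have -> : C * 2^-1 * expR (M * t) = (1 + `|p| + `|q| + `|d|) * X.
    rewrite /X /eps; field; apply/eqP; lra.
  rewrite !mulrDl mul1r; lra.
Qed.

End volterra.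

(** * The delay equation *)

Section delay_equation.
Context {R : realType}.
Local Notation mu := (@lebesgue_measure R).
Variables (al a b c tau M : R) (F r : R -> R).
Hypotheses (al01 : 0 < al < 1) (c0 : c != 0) (tau0 : 0 <= tau) (M0 : 0 < M).
Hypotheses (tF : tame M F) (tr : tame M r).
Hypothesis rE : forall t, r t = F t + volterra_op al tau (- c^-1) (a / c) (b / c) r t.

Let al0 : 0 < al. Proof. by case/andP: al01. Qed.
Let al20 : 0 < al + al. Proof. by rewrite addr_gt0. Qed.

Lemma rl_int_volterra_op g p q d f t : 0 < g -> tame M f ->
  rl_int g (volterra_op al tau p q d f) t =
  p * rl_int (g + al) f t +
  (q * rl_int (g + (al + al)) f t + d * rl_int (g + (al + al)) f (t - tau)).
Proof.
move=> g0 tf; have t1 := tame_rl_int al0 M0 tf; have t2 := tame_rl_int al20 M0 tf.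
have t3 := tame_shift tau0 t2.
rewrite (rl_intD _ g0 M0); [|exact: tameZ|by apply: tameD; exact: tameZ].
rewrite (rl_intD _ g0 M0); [|exact: tameZ|exact: tameZ].
rewrite (rl_intZ _ _ g0 M0 t1) (rl_intZ _ _ g0 M0 t2) (rl_intZ _ _ g0 M0 t3).
by rewrite rl_int_shift !(rl_int_comp _ g0 _ M0 tf).
Qed.

Let tV f p q d : tame M f -> tame M (volterra_op al tau p q d f).
Proof.
move=> tf; have t1 := tame_rl_int al0 M0 tf; have t2 := tame_rl_int al20 M0 tf.
have t3 := tame_shift tau0 t2.
by apply: tameD; [exact: tameZ|apply: tameD; exact: tameZ].
Qed.

Let rl_int_r g t : 0 < g ->
  rl_int g r t = rl_int g F t - c^-1 * rl_int (g + al) r t +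
  (a / c * rl_int (g + (al + al)) r t + b / c * rl_int (g + (al + al)) r (t - tau)).
Proof.
move=> g0.
rewrite {1}(_ : r = fun t => F t + volterra_op al tau (- c^-1) (a / c) (b / c) r t).
  by rewrite (rl_intD _ g0 M0 tF (tV _ _ _ tr)) rl_int_volterra_op//; ring.
by apply/funext => s; exact: rE.
Qed.

(** Integrating the equation for [r] with order 2 - 2 al and multiplying by [c] gives the
    contribution of J_2 r to the delay equation; only the term in [F] is left for the explicit part
    of [x] to match. *)
Lemma delay_equation_regular t :
  rl_int (2 - al) r t + c * rl_int (2 - 2 * al) r t =
  c * rl_int (2 - 2 * al) F t + a * rl_int 2 r t + b * rl_int 2 r (t - tau).
Proof.
have g0 : 0 < 2 - 2 * al by case/andP: al01 => _; lra.
rewrite (rl_int_r t g0).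
have -> : 2 - 2 * al + al = 2 - al by ring.
have -> : 2 - 2 * al + (al + al) = 2 by ring.
by field.
Qed.

Variable l : R.
Hypothesis l0 : 0 < l.
Hypothesis char_root : l `^ al + c * l `^ (al + al) = a + b * expR (- (l * tau)).

(** Integrated twice, the equation for [r] becomes one for y = J_2 r, whose transform Y converges at
    [l] when [x] is bounded. With m = l^al it reads Y (c m^2 + m - a - b exp(- l tau)) / (c m^2) =
    l^(-2) (transform of F), and the bracket on the left vanishes at the root. *)
Lemma laplace_forcing_eq0 : laplace_cvg l F -> laplace_cvg l (rl_int 2 r) ->
  laplace l F = 0.
Proof.
move=> lF ly; pose y := rl_int 2 r.
have ty : tame M y by exact: tame_rl_int.
have [l1 L1] := laplace_rl_int l0 al0 M0 ty ly.
have [l2 L2] := laplace_rl_int l0 al20 M0 ty ly.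
have [lF2 LF2] := laplace_rl_int l0 (ltr0n R 2) M0 tF lF.
have l3 := laplace_cvg_shift tau l2; have L3 := laplace_shift tau l2.
have yE : y =1 fun t => rl_int 2 F t + (- c^-1 * rl_int al y t +
    (a / c * rl_int (al + al) y t + b / c * rl_int (al + al) y (t - tau))).
  move=> t; rewrite /y rl_int_r// !(rl_int_comp _ _ _ M0 tr)//.
  by rewrite [al + 2]addrC [al + al + 2]addrC; ring.
have := eq_laplace l yE.
rewrite laplaceD//; last first.
  by apply: laplace_cvgD; [|apply: laplace_cvgD]; exact: laplace_cvgZ.
rewrite laplaceD; [|exact: laplace_cvgZ|by apply: laplace_cvgD; exact: laplace_cvgZ].
rewrite laplaceD; [|exact: laplace_cvgZ|exact: laplace_cvgZ].
rewrite !laplaceZ// L3 L1 L2 LF2 !powRN.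
have la0 : l `^ al != 0 by rewrite gt_eqF// powR_gt0.
have laa : l `^ (al + al) = l `^ al * l `^ al.
  by rewrite powRD// (gt_eqF l0) implybT.
have ll0 : l `^ 2 != 0 by rewrite gt_eqF// powR_gt0.
move: char_root; rewrite laa => root h.
have : (l `^ 2)^-1 * laplace l F = 0.
  have E : a + b * expR (- (l * tau)) - (l `^ al + c * (l `^ al * l `^ al)) = 0.
    by rewrite root subrr.
  have : (l `^ 2)^-1 * laplace l F = - (laplace l y / (c * (l `^ al * l `^ al))) *
      (a + b * expR (- (l * tau)) - (l `^ al + c * (l `^ al * l `^ al))).
    have -> : (l `^ 2)^-1 * laplace l F = laplace l y -
      (laplace l y - (l `^ 2)^-1 * laplace l F) by ring.
    rewrite [X in X - (_ * _)]h addrAC subrr add0r.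
    by field; rewrite c0 la0.
  by rewrite E mulr0.
by move=> /eqP; rewrite mulf_eq0 invr_eq0 (negbTE ll0)/= => /eqP.
Qed.

Variables (n : nat) (e beta : nat -> R) (k : R) (x : R -> R).
Hypothesis beta0 : forall i, 0 < beta i.
Hypothesis beta1 : 1 < 2 * al -> forall i, 1 < beta i.
Hypothesis xE : forall t, 0 < t ->
  x t = k + gk_sum n e (fun i => beta i + 1) t + rl_int 2 r t.

(** Up to time [T] the growth bound of J_2 r applies; afterwards J_2 r = x - k - S with [x] bounded
    and the transform of [S] convergent. [K] serves both ranges. *)
Lemma laplace_cvg_bounded : bounded_near x (pinfty_nbhs R) -> laplace_cvg l (rl_int 2 r).
Proof.
move=> /pinfty_ex_gt0[B B0 [T [_ hT]]]; have ty : tame M (rl_int 2 r) by exact: tame_rl_int.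
have [C yC] := tame_bound ty; have C0 := exp_bound_ge0 yC.
pose S := gk_sum n e (fun i => beta i + 1).
have lS : laplace_cvg l S by apply: laplace_cvg_gk_sum => // i; rewrite addr_gt0.
pose K := C * expR (M * T) + B + `|k|.
apply: (@le_integrable _ _ _ mu setT measurableT _
  (fun t => (K%:E * (gk 1 t * expR (- (l * t)))%:E + `|(S t * expR (- (l * t)))%:E|)%E)).
- apply/measurable_EFinP; apply: measurable_funM; first exact: tame_measurable ty.
  exact: measurable_expRM.
- move=> t _; rewrite abse_EFin -EFinM -EFinD abse_EFin lee_fin.
  rewrite [leRHS]ger0_norm; last first.
    by rewrite addr_ge0// !mulr_ge0 ?addr_ge0 ?mulr_ge0 ?expR_ge0 ?gk_ge0 ?(ltW B0).
  rewrite !normrM (@ger0_norm _ (expR _)) ?expR_ge0// mulrA -mulrDl ler_wpM2r ?expR_ge0//.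
  have [t0|t0] := ltP 0 t; last by rewrite (tame_le0 ty)// gk_le0E// normr0 mulr0 add0r.
  rewrite gk1E// mulr1; have [tT|tT] := leP t T.
    apply: (le_trans (yC t)); rewrite /K -!addrA.
    apply: (@le_trans _ _ (C * expR (M * T))); first by rewrite ler_wpM2l// ler_expR ler_pM2l.
    by rewrite lerDl !addr_ge0// ltW.
  have xB : `|x t| <= B by exact: hT.
  have -> : rl_int 2 r t = x t - k - S t by rewrite xE// /S; ring.
  rewrite (le_trans (ler_normB _ _))// lerD2r (le_trans (ler_normB _ _))//.
  by rewrite lerD2r (le_trans xB)// lerDr mulr_ge0 ?expR_ge0.
- apply: integrableD => //; last exact: integrable_abse.
  by apply: integrableZl => //; exact: integrable_gk.
Qed.

Let caputo_al t : 0 < t ->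
  caputo al x t = gk_sum n e (fun i => beta i + 1 - al) t + rl_int (2 - al) r t.
Proof.
by move=> t0; rewrite (caputo_expansion1 M0 tr beta0 xE)//; case/andP: al01 => -> /ltW ->.
Qed.

Let caputo_2al t : 0 < t ->
  caputo (2 * al) x t = gk_sum n e (fun i => beta i + 1 - 2 * al) t + rl_int (2 - 2 * al) r t.
Proof.
move=> t0; have [a1|a1] := ltP 1 (2 * al).
  rewrite (caputo_expansion2 M0 tr beta0 xE)//; first exact: beta1.
  by rewrite a1; case/andP: al01; lra.
by rewrite (caputo_expansion1 M0 tr beta0 xE)// a1 andbT mulr_gt0.
Qed.

(** The history is [x] itself and the initial velocity is 0. The last premise is the delay equation
    once [delay_equation_regular] has rewritten the fractional integrals of [r] that the Caputo
    derivatives produce. *)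
Lemma solution_expansion : continuous x -> x 0 = k ->
  (forall t, 0 < t ->
    gk_sum n e (fun i => beta i + 1 - al) t + c * gk_sum n e (fun i => beta i + 1 - 2 * al) t +
    c * rl_int (2 - 2 * al) F t + a * rl_int 2 r t + b * rl_int 2 r (t - tau) =
    a * x t + b * x (t - tau)) ->
  is_solution al a b c tau x 0 x.
Proof.
move=> cx x0 eqx; split.
- by [].
- exact: continuous_subspaceT.
(* [x] follows the expansion only for t > 0, its history being free on the left. [G] continues the
   expansion to all times; its derivative at 0 vanishes because 1 < beta i. *)
- move=> a1; pose G t := k + gk_sum n e (fun i => beta i + 1) t + rl_int 2 r t.
  have be1 := beta1 a1.
  have J0 g : rl_int g r 0 = 0 by apply: rl_int_le0 => //; exact: tame_le0 tr.
  have G0 : G 0 = k by rewrite /G gk_sum_le0// J0 !addr0.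
  have dG : is_derive (0 : R) 1 G 0.
    suff : is_derive (0 : R) 1 G (0 + gk_sum n e beta 0 + rl_int 1 r 0).
      by rewrite gk_sum_le0// J0 !addr0.
    apply: is_deriveD; last by have := @is_derive_rl_int R M 1 r 0 ltr01 M0 tr.
    apply: is_deriveD.
    have -> : gk_sum n e (fun i => beta i + 1) = rl_int 1 (gk_sum n e beta).
      by apply/funext => t; rewrite rl_int_gk_sum.
    apply: (@is_derive_rl_int1 _ 1) => //; first exact: laplace_cvg_gk_sum.
    suff : tame 1 (gk_sum n e beta) by move=> [+ _ _]; apply.
    elim: (n) => [|m IHm]; first by rewrite gk_sum0; exact: tame0.
    by rewrite gk_sumS; apply: tameD => //; apply: tameZ; exact: tame_gk.
  have [dG1 dG2] := dG.
  have /cvg_dnbhs_at_right : h^-1 *: (G (h *: 1 + 0) - G 0) @[h --> 0^'] --> (0 : R).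
    by rewrite -[X in _ --> X]dG2; exact: dG1.
  have E : \forall h \near 0^'+, h^-1 *: (G (h *: 1 + 0) - G 0) = h^-1 * (x h - x 0).
    by near=> h; rewrite x0 G0 addr0 /GRing.scale/= mulr1 /G -xE.
  exact: (cvg_trans (near_eq_cvg E)).
- by apply: (caputo_exists_expansion1 M0 tr beta0 xE); case/andP: al01 => -> /ltW ->.
- have [a1|a1] := ltP 1 (2 * al).
    apply: (caputo_exists_expansion2 M0 tr beta0 xE (beta1 a1)).
    by rewrite a1; case/andP: al01; lra.
  by apply: (caputo_exists_expansion1 M0 tr beta0 xE); rewrite a1 andbT mulr_gt0.
- move=> t t0; rewrite caputo_al// caputo_2al// -eqx//.
  have := delay_equation_regular t; lra.
Unshelve. all: by end_near. Qed.

Lemma unstable_expansion : continuous x -> x 0 = k ->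
  (forall t, 0 < t ->
    gk_sum n e (fun i => beta i + 1 - al) t + c * gk_sum n e (fun i => beta i + 1 - 2 * al) t +
    c * rl_int (2 - 2 * al) F t + a * rl_int 2 r t + b * rl_int 2 r (t - tau) =
    a * x t + b * x (t - tau)) ->
  laplace_cvg l F -> laplace l F != 0 -> unstable al a b c tau.
Proof.
move=> cx x0 eqx lF LF st.
have := st _ _ _ (solution_expansion cx x0 eqx) => /laplace_cvg_bounded ly.
by move: LF; rewrite laplace_forcing_eq0 ?eqxx.
Qed.

End delay_equation.

(** * Third differences and the quadratic B-spline used as history *)

Section third_difference.
Context {R : realType}.
Implicit Types (d b t l M : R) (f g : R -> R).

(** The operator (1 - shift by d)^3, expanded into sums and multiples so that the linearity lemmas
    apply literally. *)
Definition diff3 d f t :=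
  f t + (- 3 * f (t - d) + (3 * f (t - 2 * d) + -1 * f (t - 3 * d))).

Lemma tame_diff3 M d f : 0 <= d -> tame M f -> tame M (diff3 d f).
Proof.
move=> d0 tf; apply: tameD => //.
apply: tameD; first by apply: tameZ; exact: tame_shift.
by apply: tameD; apply: tameZ; apply: tame_shift => //; rewrite mulr_ge0.
Qed.

Lemma rl_int_diff3 M b d f t : 0 < b -> 0 < M -> 0 <= d -> tame M f ->
  rl_int b (diff3 d f) t = diff3 d (rl_int b f) t.
Proof.
move=> b0 M0 d0 tf.
have t1 := tame_shift d0 tf.
have t2 := tame_shift (mulr_ge0 (ler0n R 2) d0) tf.
have t3 := tame_shift (mulr_ge0 (ler0n R 3) d0) tf.
have t32 : tame M (fun t => 3 * f (t - 2 * d) + -1 * f (t - 3 * d)).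
  by apply: tameD; exact: tameZ.
rewrite (rl_intD _ b0 M0 tf); last by apply: tameD => //; exact: tameZ.
rewrite (rl_intD _ b0 M0) //; last exact: tameZ.
rewrite (rl_intD _ b0 M0); [|exact: tameZ|exact: tameZ].
by rewrite (rl_intZ _ _ b0 M0 t1) (rl_intZ _ _ b0 M0 t2) (rl_intZ _ _ b0 M0 t3) !rl_int_shift.
Qed.

Lemma laplace_diff3 l d f : laplace_cvg l f ->
  laplace_cvg l (diff3 d f) /\ laplace l (diff3 d f) = (1 - expR (- (l * d))) ^+ 3 * laplace l f.
Proof.
move=> lf.
have l1 := laplace_cvg_shift d lf.
have l2 := laplace_cvg_shift (2 * d) lf.
have l3 := laplace_cvg_shift (3 * d) lf.
have z1 := laplace_cvgZ (- 3) l1.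
have z2 := laplace_cvgZ 3 l2.
have z3 := laplace_cvgZ (-1) l3.
have z23 := laplace_cvgD z2 z3.
have z123 := laplace_cvgD z1 z23.
split; first exact: laplace_cvgD.
rewrite laplaceD// laplaceD// laplaceD// !laplaceZ// !laplace_shift//.
have -> : - (l * (2 * d)) = - (l * d) - l * d by ring.
have -> : - (l * (3 * d)) = - (l * d) - l * d - l * d by ring.
by rewrite !expRD; ring.
Qed.

(* Third differences annihilate quadratic polynomials: this quadratic B-spline
   is supported in [0, 3d]. *)
Lemma diff3_gk3_eq0 d t : 0 <= d -> 3 * d <= t -> diff3 d (gk 3) t = 0.
Proof.
move=> d0 dt.
have gE s : 0 <= s -> gk 3 s = s ^+ 2 / Gamma 3.
  rewrite le_eqVlt => /predU1P[<-|s0]; first by rewrite gk_le0E// expr0n mul0r.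
  rewrite gk_gt0E// (_ : 3 - 1 = 2%:R); last by ring.
  by rewrite powR_mulrn// ltW.
by rewrite /diff3 !gE; [ring|lra..].
Qed.

End third_difference.

(** * Instability with a positive delay *)

Section instability.
Context {R : realType}.
Variables (al a b c : R).
Hypotheses (al01 : 0 < al < 1) (c0 : c != 0).

Let al0 : 0 < al. Proof. by case/andP: al01. Qed.

Lemma unstable_pos_delay tau l : b != 0 -> 0 < tau -> 0 < l ->
  l `^ al + c * l `^ (al + al) = a + b * expR (- (l * tau)) ->
  unstable al a b c tau.
Proof.
move=> b0 tau0 l0 root; pose d := tau / 3.
have d0 : 0 < d by rewrite divr_gt0.
have [M M0 sol] := volterra_solution (- c^-1) (a / c) (b / c) al0 (ltW tau0).
(* Integration of order 2 - 2 al turns [h] into gk 3, so that c J_(2 - 2 al) F = b g for the spline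
   g. The order 2 al + 1 exceeds 1 for every al, hence [F] is continuous. *)
pose h := gk (2 * al + 1) : R -> R.
have al21 : 1 < 2 * al + 1 by rewrite ltrDr mulr_gt0.
have al20 : 0 < 2 * al + 1 by exact: lt_trans al21.
have th : tame M h by exact: tame_gk.
pose F t := b / c * diff3 d h t.
have tF : tame M F by apply: tameZ; apply: tame_diff3 => //; exact: ltW.
have [r [tr rE]] := sol _ tF.
pose x t := diff3 d (gk 3) (t + tau) + rl_int 2 r t.
have x0 t : 0 <= t -> x t = rl_int 2 r t.
  move=> t0; rewrite /x diff3_gk3_eq0 ?add0r//; first exact: ltW.
  by rewrite /d; lra.
have tg : tame M (diff3 d (gk 3)).
  by apply: tame_diff3; [exact: ltW|apply: tame_gk => //; rewrite ltr1n].
have tJ : tame M (rl_int 2 r) by exact: tame_rl_int.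
have lh : laplace_cvg l h by exact: laplace_cvg_gk.
have [lD LD] := laplace_diff3 d lh.
(* No explicit powers occur: the sum is empty, the constant is 0, and [cst 2] stands for any
   exponents above 1. *)
apply: (@unstable_expansion R al a b c tau M F r al01 c0 (ltW tau0) M0 tF tr rE l l0 root
  0%N (cst 0) (cst 2) 0 x).
- by move=> i; exact: ltr0n.
- by move=> _ i; rewrite ltr1n.
- by move=> t t0; rewrite gk_sum0 x0 ?ltW// !add0r.
- move=> t; apply: cvgD; last exact: (tame_continuous tJ).
  apply: (@continuous_comp _ _ _ (fun t => t + tau) (diff3 d (gk 3))).
    by apply: cvgD => //; exact: cvg_cst.
  exact: (tame_continuous tg).
- by rewrite x0// (tame_le0 tJ).
- move=> t t0; rewrite !gk_sum0 /= mulr0 addr0 add0r.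
  have g0 : 0 < 2 - 2 * al by case/andP: al01; lra.
  rewrite (rl_intZ _ _ g0 M0); last by apply: tame_diff3 => //; exact: ltW.
  rewrite (rl_int_diff3 _ g0 M0 (ltW d0) th).
  have -> : rl_int (2 - 2 * al) h = gk 3.
    by apply/funext => s; rewrite rl_int_gk//; congr (gk _ _); ring.
  rewrite x0 ?ltW// /x subrK; field; exact: c0.
- by apply: laplace_cvgZ.
- rewrite laplaceZ// LD laplace_gkE//.
  apply: mulf_neq0; first by apply: mulf_neq0 => //; rewrite invr_eq0.
  apply: mulf_neq0; last by rewrite gt_eqF// powR_gt0.
  rewrite expf_neq0// subr_eq0 eq_sym lt_eqF// -expR0 ltr_expR oppr_lt0.
  exact: mulr_gt0.
Qed.

End instability.

(* Consecutive coefficients (e_n, e_(n+1)) of the expansion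
   1 + \sum_n e_n gk ((n + 2) al + 1) of a solution of the equation without delay. *)
Fixpoint expansion_coefs (R : fieldType) (s c : R) (n : nat) : R * R :=
  if n is m.+1 then
    let p := expansion_coefs s c m in (p.2, (s * p.1 - p.2) / c)
  else (s / c, - (s / c) / c).

(** * Instability without delay, from a truncated generalized power series *)

Section instability_without_delay.
Context {R : realType}.
Variables (al a b c : R).
Hypotheses (al01 : 0 < al < 1) (c0 : c != 0).

Let al0 : 0 < al. Proof. by case/andP: al01. Qed.

Let s := a + b.
Let e n := (expansion_coefs s c n).1.
Let beta (i : nat) := i.+2%:R * al.

Let e0 : c * e 0%N = s. Proof. by rewrite /e/= mulrC divfK. Qed.

Let e1 : c * e 1%N + e 0%N = 0. Proof. by rewrite /e/=; field. Qed.

Let eSS n : c * e n.+2 + e n.+1 = s * e n.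
Proof. by rewrite /e/=; field. Qed.

(** The recursion balances every power except those at n al and (n + 1) al, which the truncation
    leaves incomplete; these two terms are what [F] has to supply. *)
Let telescope n t : 0 < t ->
  gk_sum n e (fun i => beta i + 1 - al) t + c * gk_sum n e (fun i => beta i + 1 - 2 * al) t +
  (c * e n * gk (n%:R * al + 1) t + (c * e n.+1 + e n) * gk (n.+1%:R * al + 1) t) =
  s * (1 + gk_sum n e (fun i => beta i + 1) t).
Proof.
move=> t0; elim: n => [|n IHn].
  by rewrite !gk_sum0 e1 e0 (mul0r al) (add0r 1) gk1E// /cst; ring.
rewrite !gk_sumS.
have -> : beta n + 1 - al = n.+1%:R * al + 1 by rewrite /beta -(natr1 n.+1); ring.
have -> : beta n + 1 - 2 * al = n%:R * al + 1 by rewrite /beta -(natr1 n.+1) -natr1; ring.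
have -> : beta n + 1 = n.+2%:R * al + 1 by [].
rewrite eSS.
transitivity (s * (1 + gk_sum n e (fun i => beta i + 1) t) + s * (e n * gk (n.+2%:R * al + 1) t)).
  by rewrite -IHn; ring.
by ring.
Qed.

(** The recursion has characteristic polynomial c X^2 + X - s = (X - m) (c X + c m + 1). The
    quantity is therefore multiplied by [m] at each step, starting from m s. *)
Let laplace_coef_neq0 m n : m != 0 -> c * m + 1 != 0 -> s = m * (c * m + 1) ->
  c * e n.+1 + (c * m + 1) * e n != 0.
Proof.
move=> m0 cm0 sE; elim: n => [|n IHn].
  have -> : c * e 1%N + (c * m + 1) * e 0%N = m * (c * e 0%N).
    by rewrite -[c * e 1%N](addrK (e 0%N)) e1; ring.
  by rewrite e0 sE !mulf_neq0.
have -> : c * e n.+2 + (c * m + 1) * e n.+1 = m * (c * e n.+1 + (c * m + 1) * e n).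
  by rewrite -[c * e n.+2](addrK (e n.+1)) eSS sE; ring.
by rewrite mulf_neq0.
Qed.

Lemma unstable_no_delay l : a + b != 0 -> 0 < l ->
  l `^ al + c * l `^ (al + al) = a + b -> unstable al a b c 0.
Proof.
move=> ab0 l0 root.
(* The bound n al > 2 yields [u] > 1, which makes [gk u] continuous. *)
have alp := al0; pose n := (Num.truncn (2 / al)).+1.
have nal : 2 < n%:R * al by rewrite -ltr_pdivrMr// truncnS_gt.
have beta_ge i : 2 * al <= beta i by rewrite /beta ler_pM2r// ler_nat.
have beta0 i : 0 < beta i by rewrite /beta mulr_gt0.
have [M M0 sol] := volterra_solution (- c^-1) (a / c) (b / c) al0 (lexx 0).
(* Integration of order 2 - 2 al raises [u] and [v] to n al + 1 and (n + 1) al + 1, the orders left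
   over in [telescope]. *)
pose u := n.+2%:R * al - 1; pose v := n.+3%:R * al - 1.
have uE : u = n%:R * al + 2 * al - 1 by rewrite /u -(natr1 n.+1) -(natr1 n); ring.
have vE : v = u + al by rewrite /v /u -(natr1 n.+2); ring.
have u1 : 1 < u by rewrite uE; lra.
have v1 : 1 < v by rewrite vE; lra.
have u0 : 0 < u by exact: lt_trans u1.
have v0 : 0 < v by exact: lt_trans v1.
pose F t := e n * gk u t + (e n.+1 + e n / c) * gk v t.
have tu := tame_gk u1 M0; have tv := tame_gk v1 M0.
have tF : tame M F by apply: tameD; exact: tameZ.
have [r [tr rE]] := sol _ tF.
pose x t := 1 + gk_sum n e (fun i => beta i + 1) t + rl_int 2 r t.
have tJ : tame M (rl_int 2 r) by exact: tame_rl_int.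
have lu : laplace_cvg l (gk u) by exact: laplace_cvg_gk.
have lv : laplace_cvg l (gk v) by exact: laplace_cvg_gk.
have root' : l `^ al + c * l `^ (al + al) = a + b * expR (- (l * 0)).
  by rewrite mulr0 oppr0 expR0 mulr1.
apply: (@unstable_expansion R al a b c 0 M F r al01 c0 (lexx 0) M0 tF tr rE l l0 root'
  n e beta 1 x) => //.
- by move=> a1 i; exact: lt_le_trans a1 (beta_ge i).
- move=> t; apply: cvgD; last exact: (tame_continuous tJ).
  apply: cvgD; first exact: cvg_cst.
  suff : tame M (gk_sum n e (fun i => beta i + 1)) by move=> [+ _ _]; apply.
  elim: (n) => [|k IHk]; first by rewrite gk_sum0; exact: tame0.
  by rewrite gk_sumS; apply: tameD => //; apply: tameZ; apply: tame_gk => //; rewrite ltrDr.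
- by rewrite /x gk_sum_le0// (tame_le0 tJ)// !addr0.
- move=> t t0; have g0 : 0 < 2 - 2 * al by case/andP: al01; lra.
  rewrite (rl_intD _ g0 M0); [|exact: tameZ|exact: tameZ].
  rewrite (rl_intZ _ _ g0 M0 tu) (rl_intZ _ _ g0 M0 tv) !rl_int_gk// subr0.
  have -> : 2 - 2 * al + u = n%:R * al + 1 by rewrite uE; ring.
  have -> : 2 - 2 * al + v = n.+1%:R * al + 1 by rewrite vE uE -natr1; ring.
  transitivity (s * (1 + gk_sum n e (fun i => beta i + 1) t) + s * rl_int 2 r t).
    by rewrite -telescope// /s; field.
  by rewrite /x /s; ring.
- by apply: laplace_cvgD; exact: laplace_cvgZ.
- rewrite laplaceD; [|exact: laplace_cvgZ|exact: laplace_cvgZ].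
  rewrite !laplaceZ// !laplace_gkE//.
  pose m := l `^ al; have m0 : m != 0 by rewrite gt_eqF// powR_gt0.
  have mm : l `^ (al + al) = m * m by rewrite powRD// (gt_eqF l0) implybT.
  have sE : s = m * (c * m + 1) by rewrite /s -root mm /m; ring.
  have cm0 : c * m + 1 != 0.
    by apply: contraNneq ab0 => h; rewrite -/s sE h mulr0.
  have -> : l `^ (- u) = l `^ (- v) * m.
    rewrite /m -powRD ?(gt_eqF l0) ?implybT//; congr (_ `^ _); rewrite vE; ring.
  have -> : e n * (l `^ (- v) * m) + (e n.+1 + e n / c) * l `^ (- v) =
      l `^ (- v) / c * (c * e n.+1 + (c * m + 1) * e n) by field.
  by rewrite !mulf_neq0 ?invr_eq0 ?laplace_coef_neq0// gt_eqF// powR_gt0.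
Qed.

End instability_without_delay.

(** * Existence of a positive root of the characteristic equation *)

Section characteristic_root.
Context {R : realType}.
Variables (al a b c tau : R).
Hypotheses (al0 : 0 < al) (tau0 : 0 <= tau) (ab0 : a + b != 0).

Let Gamma_gk_powR (be t : R) : 0 < be -> 0 <= t -> Gamma (be + 1) * gk (be + 1) t = t `^ be.
Proof.
move=> be0; rewrite le_eqVlt => /predU1P[<-|t0].
  by rewrite gk_le0E// mulr0 powR0// gt_eqF.
by rewrite gk_gt0E// addrK mulrC divfK// gt_eqF// Gamma_gt0// addr_gt0.
Qed.

(** [X] is the value of l^al at the point L. The factor a + b treats both signs at once: a + b times
    the difference of the two sides is - (a + b)^2 < 0 at 0 and nonnegative at L, where exp(- L tau)
    is one of the admissible [E]. *)
Lemma positive_characteristic_root X : 0 < X ->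
  (forall E, 0 <= E <= 1 -> (a + b) * (a + b * E) <= (a + b) * (X + c * X ^+ 2)) ->
  exists2 l, 0 < l & l `^ al + c * l `^ (al + al) = a + b * expR (- (l * tau)).
Proof.
move=> X0 hX; pose L := X `^ al^-1.
have L0 : 0 < L by exact: powR_gt0.
have La : L `^ al = X by rewrite -powRrM mulVf ?gt_eqF// powRr1// ltW.
have Laa : L `^ (al + al) = X ^+ 2.
  by rewrite powRD ?La ?expr2// (gt_eqF L0) implybT.
have al20 : 0 < al + al by exact: addr_gt0.
(* Multiples of [gk], which is zero on the left, replace the powers so that [h] is continuous on the
   whole line, including 0. *)
pose h l := (a + b) * ((Gamma (al + 1) * gk (al + 1) l +
  c * (Gamma (al + al + 1) * gk (al + al + 1) l)) - (a + b * expR (- (l * tau)))).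
have hE l : 0 <= l -> h l = (a + b) * (l `^ al + c * l `^ (al + al) - (a + b * expR (- (l * tau)))).
  by move=> l0; rewrite /h !Gamma_gk_powR.
have ch : continuous h.
  move=> l; apply: cvgM; first exact: cvg_cst.
  apply: cvgB.
    apply: cvgD; last apply: cvgM; try exact: cvg_cst.
      by apply: cvgM; [exact: cvg_cst|apply: continuous_gk_gt1; rewrite ltrDr].
    by apply: cvgM; [exact: cvg_cst|apply: continuous_gk_gt1; rewrite ltrDr].
  apply: cvgD; first exact: cvg_cst.
  apply: cvgM; first exact: cvg_cst.
  apply: continuous_comp; last exact: continuous_expR.
  by apply: cvgN; apply: cvgM => //; exact: cvg_cst.
have h0 : h 0 < 0.
  rewrite hE// !powR0 ?gt_eqF// mulr0 addr0 mul0r oppr0 expR0 mulr1 sub0r mulrN oppr_lt0.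
  by rewrite -expr2 exprn_even_gt0.
have hL : 0 <= h L.
  rewrite (hE _ (ltW L0)) La Laa mulrBr subr_ge0; apply: hX.
  by rewrite expR_ge0 -expR0 ler_expR oppr_le0 mulr_ge0// ltW.
have [|l lL hl] := @IVT _ h 0 L 0 (ltW L0) (continuous_subspaceT ch).
  by rewrite ge_min le_max (ltW h0) hL orbT.
move: lL; rewrite in_itv/= le_eqVlt => /andP[/predU1P[l0|l0] _].
  by move: hl h0; rewrite -l0 => ->; rewrite ltxx.
exists l => //; move: hl; rewrite hE ?ltW// => /eqP.
by rewrite mulf_eq0 (negbTE ab0)/= subr_eq0 => /eqP.
Qed.

End characteristic_root.

(** * Characteristic roots under each of the four conditions, and instability *)

Theorem theoremV1 (R : realType) (alpha a b c : R) (halpha : 0 < alpha < 1)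
    (hcond : [\/ [/\ 0 < c, b < 0 & 1 < (- a) / b],
                 [/\ 0 < c, 0 < b & (- a) / b < 1],
                 [/\ c < 0, b < 0 & (- a) / b < 1]
               | [/\ c < 0, b < 0 & - b < a < (- 1) / (4 * c)]]) :
  forall tau : R, 0 <= tau -> unstable alpha a b c tau.
Proof.
move=> tau tau0; have al0 : 0 < alpha by case/andP: halpha.
have bE (E : R) : 0 <= E <= 1 -> - `|b| <= b * E <= `|b|.
  move=> /andP[E0 E1]; rewrite -ler_norml normrM (ger0_norm E0).
  by rewrite ler_piMr.
have na := ler_norm a; have na' : - a <= `|a| by rewrite -normrN ler_norm.
have a0 := normr_ge0 a; have b0 := normr_ge0 b.
have [c0 [bn0 [ab0 [l l0 root]]]] : c != 0 /\ b != 0 /\ a + b != 0 /\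
    exists2 l, 0 < l & l `^ alpha + c * l `^ (alpha + alpha) = a + b * expR (- (l * tau)).
  (* The first two conditions both amount to c > 0 and a + b > 0. Then X = |a| + |b| bounds every a
     + b E, and c X^2 only helps. *)
  have pos_case : 0 < c -> b != 0 -> 0 < a + b -> c != 0 /\ b != 0 /\ a + b != 0 /\
      exists2 l, 0 < l & l `^ alpha + c * l `^ (alpha + alpha) = a + b * expR (- (l * tau)).
    move=> c0 bn0 ab0; split; first by rewrite gt_eqF.
    split => //; split; first by rewrite gt_eqF.
    apply: (@positive_characteristic_root _ _ _ _ _ _ al0 tau0 _ (`|a| + `|b|)).
    - by rewrite gt_eqF.
    - by rewrite ltr_wpDl// normr_gt0.
    - move=> E /bE /andP[_ h]; rewrite ler_pM2l//.
      have : 0 <= c * (`|a| + `|b|) ^+ 2 by rewrite mulr_ge0 ?sqr_ge0// ltW.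
      lra.
  case: hcond => [[c0 b0' h]|[c0 b0' h]|[c0 b0' h]|[c0 b0' /andP[h1 h2]]].
  - apply: pos_case => //; first by rewrite lt_eqF.
    by move: h; rewrite ltr_ndivlMr// mul1r; lra.
  - apply: pos_case => //; first by rewrite gt_eqF.
    by move: h; rewrite ltr_pdivrMr// mul1r; lra.
  - have ab0 : a + b < 0 by move: h; rewrite ltr_ndivrMr// mul1r; lra.
    do 2 (split; first by rewrite lt_eqF).
    split; first by rewrite lt_eqF.
    (* Here a + b < 0. This [X] is at least 1 and satisfies 1 + c X <= - (|a| + |b|), whence X (1 +
       c X) <= a + b E. *)
    pose X := 1 + (1 + `|a| + `|b|) / - c.
    have X1 : 1 <= X by rewrite lerDl divr_ge0 ?oppr_ge0 ?ltW//; lra.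
    apply: (@positive_characteristic_root _ _ _ _ _ _ al0 tau0 _ X).
    + by rewrite lt_eqF.
    + exact: lt_le_trans X1.
    + move=> E /bE /andP[h' _]; rewrite ler_nM2l//.
      have cX : c * X = c - (1 + `|a| + `|b|) by rewrite /X; field; rewrite lt_eqF.
      have : X * (1 + c * X) <= 1 * (1 + c * X) by rewrite ler_wnM2r// cX; lra.
      rewrite expr2 mulrDr mulr1 mulrCA cX; lra.
  - have ab0 : 0 < a + b by lra.
    split; first by rewrite lt_eqF.
    split; first by rewrite lt_eqF.
    split; first by rewrite gt_eqF.
    (* The vertex of X + c X^2, where the value - 1 / (4 c) exceeds a, and a >= a + b E since b <
       0. *)
    apply: (@positive_characteristic_root _ _ _ _ _ _ al0 tau0 _ (- 1 / (2 * c))).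
    + by rewrite gt_eqF.
    + by rewrite mulN1r oppr_gt0 invr_lt0; lra.
    + move=> E /andP[E0 _]; rewrite ler_pM2l//.
      have -> : - 1 / (2 * c) + c * (- 1 / (2 * c)) ^+ 2 = - 1 / (4 * c).
        by field; rewrite lt_eqF.
      have : b * E <= 0 by rewrite mulr_le0_ge0// ltW.
      lra.
(* At tau = 0 the history is a single point and cannot act as forcing, hence the separate
   construction. *)
move: tau0; rewrite le_eqVlt => /predU1P[t0|t0]; last exact: unstable_pos_delay t0 l0 root.
move: root; rewrite -t0 mulr0 oppr0 expR0 mulr1 => root.
exact: unstable_no_delay l0 root.
Qed.
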